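(* Let $E$ be the unital Grassmann algebra over a field $F$ of characteristic zero regarded as an $E$-algebra, where $E$ acts on itself by left and right multiplication. Then, modulo the $E$-trivial polynomials specified in the context, $\mathrm{Id}^E(E)$ is generated, as a $T_E$-ideal, by the polynomials $$[x_1,x_2,x_3],\quad [e_i,x_1,x_2]$$ for all $i\geq 1$. Moreover, $c_n^E(E)=+\infty$ for all $n\geq 1$.
   Context: All algebras are associative over a field $F$ of characteristic zero. $E$ is the unital algebra generated by $1,e_1,e_2,\ldots$ subject to $e_ie_j=-e_je_i$ for all $i,j$; it has basis $\{e_{i_1}\cdots e_{i_n}\mid i_1<\cdots<i_n,\ n\geq0\}$. Commutators are left-normed: $[a,b]=ab-ba$, $[a,b,c]=[[a,b],c]$. For a unital $F$-algebra $W$, a $W$-algebra is an $F$-algebra $A$ that is a unital $W$-bimodule such that $(a_1a_2)w=a_1(a_2w)$, $w(a_1a_2)=(wa_1)a_2$, $(a_1w)a_2=a_1(wa_2)$. Here $W=E$. The free $W$-algebra $W\langle X\rangle$ on $X=\{x_1,x_2,\ldots\}$ has $F$-basis $\{w_{i_0}x_{j_1}w_{i_1}\cdots x_{j_n}w_{i_n}\mid n\geq 1\}$, where the $w_{i_r}$ run over a fixed basis of $W$ and $j_1,\dots,j_n\ge1$ (expressions are multilinear in the $W$-entries); the product is juxtaposition followed by multiplication in $W$, $W$ acts by multiplying the outer entries, and $x_i=1_Wx_i1_W$. A $T_W$-ideal is a two-sided ideal of $W\langle X\rangle$ stable under left and right multiplication by $W$ and under all endomorphisms of $W\langle X\rangle$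 as a $W$-algebra. $\mathrm{Id}^W(A)$ is the $T_W$-ideal of all $f\in W\langle X\rangle$ vanishing under all evaluations of the variables in $A$. $P_n^W$ is the space of multilinear elements of $W\langle X\rangle$ in $x_1,\dots,x_n$ and $c_n^W(A)=\dim_FP_n^W/(P_n^W\cap\mathrm{Id}^W(A))$. Convention: the polynomials $[x,g]$, with $g=e_{i_1}\cdots e_{i_{2r}}$ a word of even length, and $[e_i,x,e_j]$, $i,j\geq1$, are regarded as $E$-trivial; ''generated modulo the $E$-trivial polynomials'' means that $\mathrm{Id}^E(E)$ is the $T_E$-ideal generated by the displayed polynomials together with these. *)

(* Defs.v *)
From HB Require Import structures.
From mathcomp Require Import all_boot all_order all_algebra.
From mathcomp Require Import finmap.
From mathcomp.multinomials Require Import monalg.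
From Stdlib Require Import ClassicalEpsilon.

Set Implicit Arguments.
Unset Strict Implicit.
Unset Printing Implicit Defensive.

Import GRing.Theory.
Local Open Scope ring_scope.

(* {malg F[K]} is used only as the F-vector space with basis K.                *)
HB.lock Definition mlin (F : fieldType) (K : choiceType) (V : lmodType F)
  (h : K -> V) (g : {malg F[K]}) : V := \sum_(k <- msupp g) g@_k *: h k.
Canonical mlin_unlockable := Unlockable mlin.unlock.
Arguments mlin {F K V}.

Section LinearExtension.
Context {F : fieldType} {K : choiceType} {V : lmodType F}.
Implicit Types (h : K -> V) (g : {malg F[K]}).

Lemma mlinEw h (d : {fset K}) g : fsubset (msupp g) d ->
  mlin h g = \sum_(k <- d) g@_k *: h k.
Proof.
move=> sd; rewrite mlin.unlock (big_fset_incl _ sd) // => k _ nk.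
by rewrite (mcoeff_outdom nk) scale0r.
Qed.

Lemma mlinP h c g1 g2 : mlin h (c *: g1 + g2) = c *: mlin h g1 + mlin h g2.
Proof.
pose d := fsetU (msupp g1) (msupp g2).
rewrite (mlinEw h (d := d)); last first.
  apply: (fsubset_trans (msuppD_le _ _)); apply: fsetSU; exact: msuppZ_le.
rewrite (mlinEw h (fsubsetUl _ _ : fsubset (msupp g1) d)).
rewrite (mlinEw h (fsubsetUr _ _ : fsubset (msupp g2) d)).
rewrite scaler_sumr -big_split /=; apply: eq_bigr => k _.
by rewrite mcoeffD mcoeffZ scalerDl scalerA.
Qed.

Lemma mlin0 h : mlin h 0 = 0.
Proof. by rewrite mlin.unlock msupp0 big_seq_fset0. Qed.

Lemma mlinU h c k : mlin h << c *g k >> = c *: h k.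
Proof.
rewrite (mlinEw h (msuppU_le (k := k) (x := c))) big_seq_fset1.
by rewrite mcoeffUU.
Qed.

Lemma eq_mlin h1 h2 : h1 =1 h2 -> mlin h1 =1 mlin h2.
Proof. by move=> eh g; rewrite mlin.unlock; apply: eq_bigr => k _; rewrite eh. Qed.

Lemma mlinPl h1 h2 c g :
  mlin (fun k => c *: h1 k + h2 k) g = c *: mlin h1 g + mlin h2 g.
Proof.
rewrite mlin.unlock scaler_sumr -big_split /=; apply: eq_bigr => k _.
by rewrite scalerDr !scalerA mulrC.
Qed.

End LinearExtension.

Section LinearMaps.
Context {F : fieldType}.

Lemma lin_comp (U V W : lmodType F) (f : V -> W) (g : U -> V) :
  linear f -> linear g -> linear (fun u => f (g u)).
Proof. by move=> lf lg c u v; rewrite lg lf. Qed.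

Lemma lin0 (U V : lmodType F) (f : U -> V) : linear f -> f 0 = 0.
Proof.
move=> lf; have := lf 1 0 0; rewrite !scale1r add0r.
by move/(congr1 (fun z => z - f 0)); rewrite subrr addrK => /esym.
Qed.

Lemma linZ (U V : lmodType F) (f : U -> V) c u :
  linear f -> f (c *: u) = c *: f u.
Proof. by move=> lf; have := lf c u 0; rewrite (lin0 lf) !addr0. Qed.

Lemma linD (U V : lmodType F) (f : U -> V) u v :
  linear f -> f (u + v) = f u + f v.
Proof. by move=> lf; have := lf 1 u v; rewrite !scale1r. Qed.

Lemma malgUZ (K : choiceType) c (k : K) :
  << c *g k >> = c *: << k >> :> {malg F[K]}.
Proof. by apply/malgP => k'; rewrite mcoeffZ !mcoeffU mulrnAr mulr1. Qed.

Lemma lin_sum (U V : lmodType F) (f : U -> V) (I : Type) (r : seq I) G :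
  linear f -> f (\sum_(i <- r) G i) = \sum_(i <- r) f (G i).
Proof.
move=> lf; elim: r => [|i r IH]; first by rewrite !big_nil lin0.
by rewrite !big_cons linD // IH.
Qed.

Lemma lin_mlin (K : choiceType) (U V : lmodType F) (f : U -> V) h
    (g : {malg F[K]}) :
  linear f -> f (mlin h g) = mlin (fun k => f (h k)) g.
Proof.
by move=> lf; rewrite mlin.unlock lin_sum //; apply: eq_bigr => k _; rewrite linZ.
Qed.

Lemma mlin_id (K : choiceType) (g : {malg F[K]}) : mlin (fun k => << k >>) g = g.
Proof.
by rewrite mlin.unlock [RHS]monalgE; apply: eq_bigr => k _; rewrite -malgUZ.
Qed.

Lemma lin_ext (K : choiceType) (V : lmodType F) (f1 f2 : {malg F[K]} -> V) :
  linear f1 -> linear f2 -> (forall k, f1 << k >> = f2 << k >>) -> f1 =1 f2.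
Proof.
move=> l1 l2 e g; rewrite -[g]mlin_id !lin_mlin //; exact: eq_mlin.
Qed.

Lemma scale_if_exp (V : lmodType F) (x : F) (b : bool) m n p q (u : V) :
  (m + n = p + q)%N ->
  x ^+ m *: (if b then x ^+ n *: u else 0) =
  x ^+ p *: (if b then x ^+ q *: u else 0).
Proof. by case: b => [|_]; rewrite ?scaler0 // !scalerA -!exprD => ->. Qed.

Lemma exchange_mlin (K L : choiceType) (V : lmodType F) (h : K -> L -> V)
    (f : {malg F[K]}) (g : {malg F[L]}) :
  mlin (fun k => mlin (h k) g) f = mlin (fun l => mlin (h^~ l) f) g.
Proof.
rewrite mlin.unlock; under eq_bigr => k _ do rewrite scaler_sumr.
under [RHS]eq_bigr => k _ do rewrite scaler_sumr.
rewrite exchange_big /=; apply: eq_bigr => i _; apply: eq_bigr => j _.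
by rewrite !scalerA mulrC.
Qed.

Lemma mlin_linr (K : choiceType) (U V : lmodType F) (h : U -> K -> V) g :
  (forall k, linear (h^~ k)) -> linear (fun u => mlin (h u) g).
Proof. by move=> lh c u v; rewrite -mlinPl; apply: eq_mlin => k; exact: lh. Qed.

Lemma mlin_lin (K : choiceType) (V : lmodType F) (h : K -> V) :
  linear (mlin h).
Proof. by move=> c u v; rewrite mlinP. Qed.

End LinearMaps.

Section GrassmannProduct.
Context {F : fieldType}.
Local Notation E := {malg F[{fset nat}]}.

Definition ninv (A B : {fset nat}) : nat :=
  (\sum_(a <- A) \sum_(b <- B) (b < a)%N)%N.

(* Sorting e_A e_B takes ninv A B transpositions; a repeated generator kills   *)
(* the product: e_i ^ 2 = - e_i ^ 2, so e_i ^ 2 = 0 when 2 is invertible.      *)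
Definition gbmul (A B : {fset nat}) : E :=
  if fdisjoint A B then (-1) ^+ ninv A B *: << fsetU A B >> else 0.

Definition gmul (f g : E) : E := mlin (fun A => mlin (gbmul A) g) f.

Lemma gmul_linl g : linear (gmul^~ g).
Proof. exact: mlin_lin. Qed.

Lemma gmul_linr f : linear (gmul f).
Proof. by apply: mlin_linr => A; exact: mlin_lin. Qed.

Lemma gmulUU A B : gmul << A >> << B >> = gbmul A B.
Proof. by rewrite /gmul !mlinU !scale1r. Qed.

Lemma gmulZl c f g : gmul (c *: f) g = c *: gmul f g.
Proof. exact: (linZ c f (gmul_linl g)). Qed.

Lemma gmulZr c f g : gmul f (c *: g) = c *: gmul f g.
Proof. exact: (linZ c g (gmul_linr f)). Qed.

Lemma gmul0g g : gmul 0 g = 0.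
Proof. exact: (lin0 (gmul_linl g)). Qed.

Lemma gmulg0 f : gmul f 0 = 0.
Proof. exact: (lin0 (gmul_linr f)). Qed.

Lemma big_disjU (A B : {fset nat}) (G : nat -> nat) : fdisjoint A B ->
  (\sum_(k <- fsetU A B) G k = \sum_(k <- A) G k + \sum_(k <- B) G k)%N.
Proof.
move=> dAB; rewrite -big_cat; apply: perm_big; apply: uniq_perm => //=.
  rewrite cat_uniq !fset_uniq andbT /=; apply/hasPn => k kB.
  by apply: contraL kB => kA; exact: (fdisjointP dAB).
by move=> k; rewrite mem_cat in_fsetU.
Qed.

Lemma ninvUl A B C : fdisjoint A B ->
  ninv (fsetU A B) C = (ninv A C + ninv B C)%N.
Proof. by move=> dAB; rewrite /ninv big_disjU. Qed.

Lemma ninvUr A B C : fdisjoint B C ->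
  ninv A (fsetU B C) = (ninv A B + ninv A C)%N.
Proof.
move=> dBC; rewrite /ninv -big_split /=; apply: eq_bigr => a _.
by rewrite big_disjU.
Qed.

Lemma gmulA : associative gmul.
Proof.
move=> f g h; move: f.
apply: lin_ext => [||A]; first exact: gmul_linl.
  by apply: (lin_comp (gmul_linl h)); exact: gmul_linl.
move: g; apply: lin_ext => [||B].
- by apply: (lin_comp (gmul_linr _)); exact: gmul_linl.
- by apply: (lin_comp (gmul_linl _)); exact: gmul_linr.
move: h; apply: lin_ext => [||C].
- by apply: (lin_comp (gmul_linr _)); exact: gmul_linr.
- exact: gmul_linr.
rewrite (gmulUU B C) (gmulUU A B) [gbmul B C]/gbmul [gbmul A B]/gbmul.
case: (boolP (fdisjoint B C)) => dBC; case: (boolP (fdisjoint A B)) => dAB.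
- rewrite gmulZr gmulZl !gmulUU /gbmul fdisjointXU fdisjointUX dAB dBC andbT.
  rewrite fsetUA; apply: scale_if_exp.
  by rewrite (ninvUl _ dAB) (ninvUr _ dBC) addnC -addnA.
- rewrite gmulZr gmulUU /gbmul fdisjointXU (negbTE dAB) gmul0g.
  exact: scaler0.
- rewrite gmulZl gmulUU /gbmul fdisjointUX (negbTE dBC) andbF gmulg0.
  by apply: esym; exact: scaler0.
- by rewrite gmulg0 gmul0g.
Qed.

Definition gone : E := << fset0 >>.

Lemma gmul1 : left_id gone gmul.
Proof.
apply: lin_ext => [||A]; [exact: gmul_linr | by [] |].
rewrite gmulUU /gbmul fdisjoint0X fset0U /ninv big_seq_fset0 expr0.
exact: scale1r.
Qed.

Lemma gmulr1 : right_id gone gmul.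
Proof.
apply: lin_ext => [||A]; [exact: gmul_linl | by [] |].
rewrite gmulUU /gbmul fdisjointX0 fsetU0 /ninv big1 => [|a _]; last first.
  by rewrite big_seq_fset0.
by rewrite expr0; exact: scale1r.
Qed.

Lemma gmulDl : left_distributive gmul +%R.
Proof. by move=> f g h; rewrite (linD _ _ (gmul_linl h)). Qed.

Lemma gmulDr : right_distributive gmul +%R.
Proof. by move=> f g h; rewrite (linD _ _ (gmul_linr f)). Qed.

Lemma gone_neq0 : gone != 0.
Proof. by rewrite /gone monalgU_eq0 oner_neq0. Qed.

End GrassmannProduct.

(* The basis element attached to A = {i_1 < ... < i_n} is the product          *)
(* e_(i_1) ... e_(i_n); generators are indexed from 0.                         *)
Definition grassmann (F : fieldType) : Type := {malg F[{fset nat}]}.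

Section Grassmann.
Context {F : fieldType}.
Local Notation E := (grassmann F).

HB.instance Definition _ := GRing.Lmodule.on E.
HB.instance Definition _ := GRing.Zmodule_isNzRing.Build E
  gmulA gmul1 gmulr1 gmulDl gmulDr gone_neq0.

Fact gscaleAl (c : F) (f g : E) : c *: (f * g) = c *: f * g.
Proof. by rewrite -(linZ c f (gmul_linl g)). Qed.

HB.instance Definition _ := GRing.Lmodule_isLalgebra.Build F E gscaleAl.

Fact gscaleAr (c : F) (f g : E) : c *: (f * g) = f * (c *: g).
Proof. by rewrite -(linZ c g (gmul_linr f)). Qed.

HB.instance Definition _ := GRing.Lalgebra_isAlgebra.Build F E gscaleAr.

Definition gen (i : nat) : E := << fset1 i >>.

Lemma grassmannUU A B : (<< A >> : E) * (<< B >> : E) = gbmul A B.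
Proof. exact: gmulUU. Qed.

Lemma ninv11 i j : ninv (fset1 i) (fset1 j) = (j < i)%N.
Proof. by rewrite /ninv !big_seq_fset1. Qed.

Lemma genM i j : gen i * gen j = - (gen j * gen i).
Proof.
have sgn (V : lmodType F) (v : V) : (-1) ^+ 0 *: v = - ((-1) ^+ 1 *: v).
  by rewrite expr0 expr1 scaleN1r opprK scale1r.
rewrite !grassmannUU /gbmul !fdisjoint1X !in_fset1 !ninv11 (eq_sym j i).
case: (ltngtP i j) => [_|_|_]; last by rewrite /= oppr0.
  by rewrite fsetUC; exact: sgn.
by rewrite fsetUC; apply: oppr_inj; rewrite opprK; apply: esym; exact: sgn.
Qed.

Lemma gen_prod (s : seq nat) : sorted ltn s ->
  \prod_(i <- s) gen i = << seq_fset tt s >>.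
Proof.
elim: s => [_|i s IH].
  rewrite big_nil; suff -> : seq_fset tt [::] = fset0 :> {fset nat} by [].
  by apply/fsetP => k; rewrite seq_fsetE.
move=> /= si; rewrite big_cons IH ?(path_sorted si) // grassmannUU /gbmul.
have lti k : k \in s -> (i < k)%N.
  by move: si; rewrite (path_sortedE ltn_trans) => /andP[/allP si _] /si.
have -> : fdisjoint [fset i]%fset (seq_fset tt s).
  by rewrite fdisjoint1X seq_fsetE; apply/negP => /lti; rewrite ltnn.
have -> : ninv [fset i]%fset (seq_fset tt s) = 0%N.
  rewrite /ninv big_seq_fset1 big_seq big1 // => k.
  by rewrite seq_fsetE => /lti lik; rewrite ltnNge (ltnW lik).
have -> : fsetU [fset i]%fset (seq_fset tt s) = seq_fset tt (i :: s).
  by apply/fsetP => k; rewrite in_fsetU in_fset1 !seq_fsetE.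
by rewrite expr0; exact: scale1r.
Qed.

End Grassmann.

(* Algebras are not required to be unital, so W-algebras extend lmodType.      *)
HB.mixin Record isWAlgebra (F : fieldType) (W : algType F) A
    of GRing.Lmodule F A := {
  wmul : A -> A -> A;
  lact : W -> A -> A;
  ract : A -> W -> A;
  wmul_linl : forall b, linear (wmul^~ b);
  wmul_linr : forall a, linear (wmul a);
  lact_linl : forall a, linear (lact^~ a);
  lact_linr : forall w, linear (lact w);
  ract_linl : forall w, linear (ract^~ w);
  ract_linr : forall a, linear (ract a);
  wmulA : associative wmul;
  lact1 : forall a, lact 1 a = a;
  ract1 : forall a, ract a 1 = a;
  lactM : forall w w' a, lact (w * w') a = lact w (lact w' a);
  ractM : forall a w w', ract a (w * w') = ract (ract a w) w';
  lact_ract : forall w a w', ract (lact w a) w' = lact w (ract a w');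
  wmul_ract : forall a b w, ract (wmul a b) w = wmul a (ract b w);
  lact_wmul : forall w a b, lact w (wmul a b) = wmul (lact w a) b;
  wmul_mid : forall a w b, wmul (ract a w) b = wmul a (lact w b)
}.

#[short(type="walgType")]
HB.structure Definition WAlgebra (F : fieldType) (W : algType F) :=
  {A of GRing.Lmodule F A & isWAlgebra F W A}.

Arguments wmul {F W} {s} : rename.
Arguments lact {F W} {s} : rename.
Arguments ract {F W} {s} : rename.

Section Commutators.
Context {F : fieldType} {W : algType F} {A : walgType W}.

Definition wcomm (a b : A) : A := wmul a b - wmul b a.
Definition lcomm (w : W) (a : A) : A := lact w a - ract a w.
Definition rcomm (a : A) (w : W) : A := ract a w - lact w a.

End Commutators.

Definition walg_morph (F : fieldType) (W : algType F) (A B : walgType W)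
    (phi : A -> B) : Prop :=
  [/\ linear phi,
      forall a b, phi (wmul a b) = wmul (phi a) (phi b),
      forall w a, phi (lact w a) = lact w (phi a) &
      forall a w, phi (ract a w) = ract (phi a) w].

Definition regular (F : fieldType) (W : algType F) : Type := W.

Section Regular.
Context {F : fieldType} (W : algType F).

HB.instance Definition _ := GRing.Lmodule.on (regular W).

Fact regular_linl (b : W) : linear (fun a : W => a * b).
Proof. by move=> c u v; rewrite mulrDl scalerAl. Qed.

Fact regular_linr (a : W) : linear (fun b : W => a * b).
Proof. by move=> c u v; rewrite mulrDr scalerAr. Qed.

HB.instance Definition _ := @isWAlgebra.Build F W (regular W)
  *%R *%R *%R regular_linl regular_linr regular_linl regular_linr
  regular_linl regular_linr (@mulrA W) (@mul1r W) (@mulr1 W)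
  (fun a b c => esym (mulrA a b c)) (@mulrA W)
  (fun a b c => esym (mulrA a b c)) (fun a b c => esym (mulrA a b c))
  (@mulrA W) (fun a b c => esym (mulrA a b c)).

End Regular.

Record basis (F : fieldType) (W : lmodType F) := Basis {
  bidx :> choiceType;
  bvec : bidx -> W;
  bcoord : W -> {malg F[bidx]};
  bcoordK : forall w, mlin bvec (bcoord w) = w;
  bvecK : forall g, bcoord (mlin bvec g) = g
}.

Section FreeWAlgebra.
Context {F : fieldType} {W : algType F} (B : basis W).

(* (i_0, (j_1, [:: (i_1, j_2); ..; (i_(n-1), j_n)]), i_n) stands for           *)
(* b_(i_0) x_(j_1) b_(i_1) x_(j_2) .. x_(j_n) b_(i_n), with n >= 1; variables  *)
(* are indexed from 0.                                                         *)
Definition wmonom : Type := (B * (nat * seq (B * nat)) * B)%type.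
HB.instance Definition _ := Choice.on wmonom.

Definition freeW : Type := {malg F[wmonom]}.
HB.instance Definition _ := GRing.Lmodule.on freeW.

Definition mon (m : wmonom) : freeW := << m >>.

Definition mjoin (c : nat * seq (B * nat)) (k : B) (c' : nat * seq (B * nat)) :=
  (c.1, c.2 ++ (k, c'.1) :: c'.2).

Definition mon_mul (m m' : wmonom) : freeW :=
  mlin (fun k => mon (m.1.1, mjoin m.1.2 k m'.1.2, m'.2))
       (bcoord B (bvec m.2 * bvec m'.1.1)).

Definition free_mul (f g : freeW) : freeW :=
  mlin (fun m => mlin (mon_mul m) g) f.

Definition free_lact (w : W) (f : freeW) : freeW :=
  mlin (fun m => mlin (fun k => mon (k, m.1.2, m.2))
                      (bcoord B (w * bvec m.1.1))) f.

Definition free_ract (f : freeW) (w : W) : freeW :=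
  mlin (fun m => mlin (fun k => mon (m.1, k)) (bcoord B (bvec m.2 * w))) f.

Lemma bcoord_lin : linear (bcoord B).
Proof.
by move=> c u v; rewrite -[u in LHS](bcoordK B) -[v in LHS](bcoordK B) -mlinP bvecK.
Qed.

Lemma bcoordU k : bcoord B (bvec k) = << k >>.
Proof. by rewrite -[RHS]bvecK mlinU scale1r. Qed.

(* The element w c w' of W<X>, for arbitrary outer coefficients w and w'.      *)
Definition sandwich (w : W) c (w' : W) : freeW :=
  mlin (fun k => mlin (fun k' => mon (k, c, k')) (bcoord B w')) (bcoord B w).

Lemma sandwich_linl c w' : linear (fun w => sandwich w c w').
Proof. by apply: (lin_comp (mlin_lin _)); exact: bcoord_lin. Qed.

Lemma sandwich_linr w c : linear (sandwich w c).
Proof.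
apply: mlin_linr => k.
by apply: (lin_comp (mlin_lin _)); exact: bcoord_lin.
Qed.

Lemma monE m : mon m = sandwich (bvec m.1.1) m.1.2 (bvec m.2).
Proof. by case: m => [[l c] r]; rewrite /sandwich !bcoordU !mlinU !scale1r. Qed.

Definition xvar (j : nat) : freeW := sandwich 1 (j, [::]) 1.

Lemma free_mul_linl g : linear (free_mul^~ g).
Proof. exact: mlin_lin. Qed.

Lemma free_mul_linr f : linear (free_mul f).
Proof. by apply: mlin_linr => m; exact: mlin_lin. Qed.

Lemma free_lact_linr w : linear (free_lact w).
Proof. exact: mlin_lin. Qed.

Lemma free_lact_linl f : linear (free_lact^~ f).
Proof.
apply: mlin_linr => m; apply: (lin_comp (mlin_lin _)).
by apply: (lin_comp bcoord_lin); exact: regular_linl.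
Qed.

Lemma free_ract_linl w : linear (free_ract^~ w).
Proof. exact: mlin_lin. Qed.

Lemma free_ract_linr f : linear (free_ract f).
Proof.
apply: mlin_linr => m; apply: (lin_comp (mlin_lin _)).
by apply: (lin_comp bcoord_lin); exact: regular_linr.
Qed.

Lemma free_ind (V : lmodType F) (f1 f2 : freeW -> V) :
  linear f1 -> linear f2 -> (forall m, f1 (mon m) = f2 (mon m)) -> f1 =1 f2.
Proof. exact: lin_ext. Qed.

Lemma basis_ind (V : lmodType F) (f1 f2 : W -> V) : linear f1 -> linear f2 ->
  (forall k : B, f1 (bvec k) = f2 (bvec k)) -> f1 =1 f2.
Proof.
move=> l1 l2 e w; rewrite -(bcoordK B w) !lin_mlin //; exact: eq_mlin.
Qed.

Lemma free_lactS w u c v : free_lact w (sandwich u c v) = sandwich (w * u) c v.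
Proof.
move: u; apply: basis_ind => [||k].
- by apply: (lin_comp (free_lact_linr w)); exact: sandwich_linl.
- by apply: (lin_comp (sandwich_linl c v)); exact: regular_linr.
move: v; apply: basis_ind => [||k'].
- by apply: (lin_comp (free_lact_linr w)); exact: sandwich_linr.
- exact: sandwich_linr.
rewrite -(monE (k, c, k')) /free_lact mlinU scale1r /= /sandwich.
by apply: eq_mlin => j; rewrite bcoordU mlinU scale1r.
Qed.

Lemma free_ractS w u c v : free_ract (sandwich u c v) w = sandwich u c (v * w).
Proof.
move: u; apply: basis_ind => [||k].
- by apply: (lin_comp (free_ract_linl w)); exact: sandwich_linl.
- exact: sandwich_linl.
move: v; apply: basis_ind => [||k'].
- by apply: (lin_comp (free_ract_linl w)); exact: sandwich_linr.
- by apply: (lin_comp (sandwich_linr _ c)); exact: regular_linl.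
rewrite -(monE (k, c, k')) /free_ract mlinU scale1r /= /sandwich.
by rewrite bcoordU mlinU scale1r.
Qed.

(* For fixed outer entries, the value of u c w c' v is linear in w.            *)
Definition sandwich2 u c (w : W) c' v : freeW :=
  mlin (fun k => sandwich u (mjoin c k c') v) (bcoord B w).

Lemma sandwich2_linl c w c' v : linear (fun u => sandwich2 u c w c' v).
Proof. by apply: mlin_linr => k; exact: sandwich_linl. Qed.

Lemma sandwich2_linr u c w c' : linear (sandwich2 u c w c').
Proof. by apply: mlin_linr => k; exact: sandwich_linr. Qed.

Lemma sandwich2_linm u c c' v : linear (fun w => sandwich2 u c w c' v).
Proof. by apply: (lin_comp (mlin_lin _)); exact: bcoord_lin. Qed.

Lemma free_mulS u c v u' c' v' :
  free_mul (sandwich u c v) (sandwich u' c' v') = sandwich2 u c (v * u') c' v'.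
Proof.
move: u; apply: basis_ind => [||k].
- by apply: (lin_comp (free_mul_linl _)); exact: sandwich_linl.
- exact: sandwich2_linl.
move: v; apply: basis_ind => [||l].
- by apply: (lin_comp (free_mul_linl _)); exact: sandwich_linr.
- by apply: (lin_comp (sandwich2_linm _ _ _ _)); exact: regular_linl.
move: u'; apply: basis_ind => [||k'].
- by apply: (lin_comp (free_mul_linr _)); exact: sandwich_linl.
- by apply: (lin_comp (sandwich2_linm _ _ _ _)); exact: regular_linr.
move: v'; apply: basis_ind => [||l'].
- by apply: (lin_comp (free_mul_linr _)); exact: sandwich_linr.
- exact: sandwich2_linr.
rewrite -(monE (k, c, l)) -(monE (k', c', l')) /free_mul !mlinU !scale1r.
rewrite /mon_mul /sandwich2 /=; apply: eq_mlin => j.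
by rewrite -(monE (k, _, l')).
Qed.

Lemma free_mulA : associative free_mul.
Proof.
move=> f g h; move: f.
apply: free_ind => [||m]; first exact: free_mul_linl.
  by apply: (lin_comp (free_mul_linl h)); exact: free_mul_linl.
move: g; apply: free_ind => [||m'].
- by apply: (lin_comp (free_mul_linr _)); exact: free_mul_linl.
- by apply: (lin_comp (free_mul_linl _)); exact: free_mul_linr.
move: h; apply: free_ind => [||m''].
- by apply: (lin_comp (free_mul_linr _)); exact: free_mul_linr.
- exact: free_mul_linr.
rewrite !monE !free_mulS /sandwich2.
rewrite (lin_mlin _ _ (free_mul_linr _)).
rewrite (lin_mlin _ _ (free_mul_linl _)).
under eq_mlin => k do rewrite free_mulS /sandwich2.
under [RHS]eq_mlin => k do rewrite free_mulS /sandwich2.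
rewrite exchange_mlin; apply: eq_mlin => k; apply: eq_mlin => k'.
by rewrite /mjoin /= -catA.
Qed.

Lemma free_lact1 f : free_lact 1 f = f.
Proof.
move: f; apply: free_ind => [||m]; [exact: free_lact_linr | by [] |].
by rewrite monE free_lactS mul1r.
Qed.

Lemma free_ract1 f : free_ract f 1 = f.
Proof.
move: f; apply: free_ind => [||m]; [exact: free_ract_linl | by [] |].
by rewrite monE free_ractS mulr1.
Qed.

Lemma free_lactM w w' f : free_lact (w * w') f = free_lact w (free_lact w' f).
Proof.
move: f; apply: free_ind => [||m]; first exact: free_lact_linr.
  by apply: (lin_comp (free_lact_linr w)); exact: free_lact_linr.
by rewrite monE !free_lactS mulrA.
Qed.

Lemma free_ractM f w w' : free_ract f (w * w') = free_ract (free_ract f w) w'.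
Proof.
move: f; apply: free_ind => [||m]; first exact: free_ract_linl.
  by apply: (lin_comp (free_ract_linl w')); exact: free_ract_linl.
by rewrite monE !free_ractS mulrA.
Qed.

Lemma free_lact_ract w f w' :
  free_ract (free_lact w f) w' = free_lact w (free_ract f w').
Proof.
move: f; apply: free_ind => [||m].
- by apply: (lin_comp (free_ract_linl w')); exact: free_lact_linr.
- by apply: (lin_comp (free_lact_linr w)); exact: free_ract_linl.
by rewrite monE !free_lactS !free_ractS free_lactS.
Qed.

Lemma free_mul_ract f g w :
  free_ract (free_mul f g) w = free_mul f (free_ract g w).
Proof.
move: f; apply: free_ind => [||m].
- by apply: (lin_comp (free_ract_linl w)); exact: free_mul_linl.
- exact: free_mul_linl.
move: g; apply: free_ind => [||m'].
- by apply: (lin_comp (free_ract_linl w)); exact: free_mul_linr.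
- by apply: (lin_comp (free_mul_linr _)); exact: free_ract_linl.
rewrite !monE free_mulS free_ractS free_mulS /sandwich2.
rewrite (lin_mlin _ _ (free_ract_linl w)).
by apply: eq_mlin => k; rewrite free_ractS.
Qed.

Lemma free_lact_mul w f g :
  free_lact w (free_mul f g) = free_mul (free_lact w f) g.
Proof.
move: f; apply: free_ind => [||m].
- by apply: (lin_comp (free_lact_linr w)); exact: free_mul_linl.
- by apply: (lin_comp (free_mul_linl _)); exact: free_lact_linr.
move: g; apply: free_ind => [||m'].
- by apply: (lin_comp (free_lact_linr w)); exact: free_mul_linr.
- exact: free_mul_linr.
rewrite !monE free_mulS free_lactS free_mulS /sandwich2.
rewrite (lin_mlin _ _ (free_lact_linr w)).
by apply: eq_mlin => k; rewrite free_lactS.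
Qed.

Lemma free_mul_mid f w g :
  free_mul (free_ract f w) g = free_mul f (free_lact w g).
Proof.
move: f; apply: free_ind => [||m].
- by apply: (lin_comp (free_mul_linl _)); exact: free_ract_linl.
- exact: free_mul_linl.
move: g; apply: free_ind => [||m'].
- exact: free_mul_linr.
- by apply: (lin_comp (free_mul_linr _)); exact: free_lact_linr.
by rewrite !monE free_ractS free_lactS !free_mulS mulrA.
Qed.

HB.instance Definition _ := @isWAlgebra.Build F W freeW
  free_mul free_lact free_ract free_mul_linl free_mul_linr
  free_lact_linl free_lact_linr free_ract_linl free_ract_linr
  free_mulA free_lact1 free_ract1 free_lactM free_ractM free_lact_ract
  free_mul_ract free_lact_mul free_mul_mid.

Section Evaluation.
Context {A : walgType W}.

Definition eval_core (a : nat -> A) (u : A) (s : seq (B * nat)) : A :=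
  foldl (fun v p => wmul (ract v (bvec p.1)) (a p.2)) u s.

Definition eval_mon (a : nat -> A) (m : wmonom) : A :=
  ract (eval_core a (lact (bvec m.1.1) (a m.1.2.1)) m.1.2.2) (bvec m.2).

Definition weval (a : nat -> A) : freeW -> A := mlin (eval_mon a).

Lemma eval_core_lin a s : linear (fun u => eval_core a u s).
Proof.
elim: s => [|p s IH] //= c u v; rewrite -IH; congr (eval_core a _ s).
by rewrite (ract_linl _ c) (wmul_linl _ c).
Qed.

Lemma weval_lin a : linear (weval a).
Proof. exact: mlin_lin. Qed.

Lemma wevalS a w c w' : weval a (sandwich w c w') =
  ract (eval_core a (lact w (a c.1)) c.2) w'.
Proof.
move: w; apply: basis_ind => [||k].
- by apply: (lin_comp (weval_lin a)); exact: sandwich_linl.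
- apply: (lin_comp (ract_linl w')); apply: (lin_comp (eval_core_lin a _)).
  exact: lact_linl.
move: w'; apply: basis_ind => [||k'].
- by apply: (lin_comp (weval_lin a)); exact: sandwich_linr.
- exact: ract_linr.
by rewrite -(monE (k, c, k')) /weval mlinU scale1r.
Qed.

Lemma weval_xvar a j : weval a (xvar j) = a j.
Proof. by rewrite wevalS /= lact1 ract1. Qed.

Lemma eval_core_lact a w u s :
  eval_core a (lact w u) s = lact w (eval_core a u s).
Proof.
elim: s u => [|p s IH] u //=.
by rewrite lact_ract -lact_wmul IH.
Qed.

Lemma eval_core_wmul a b u s :
  eval_core a (wmul b u) s = wmul b (eval_core a u s).
Proof. by elim: s u => [|p s IH] u //=; rewrite wmul_ract -wmulA IH. Qed.

Lemma weval_morph a : walg_morph (weval a).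
Proof.
split; first exact: weval_lin.
- move=> f g; move: f; apply: free_ind => [||m].
  + by apply: (lin_comp (weval_lin a)); exact: free_mul_linl.
  + by apply: (lin_comp (wmul_linl _)); exact: weval_lin.
  move: g; apply: free_ind => [||m'].
  + by apply: (lin_comp (weval_lin a)); exact: free_mul_linr.
  + by apply: (lin_comp (wmul_linr _)); exact: weval_lin.
  rewrite !monE [wmul (sandwich _ _ _) _]free_mulS /sandwich2.
  rewrite (lin_mlin _ _ (weval_lin a)).
  rewrite !wevalS; set X := eval_core a _ m.1.2.2.
  set Y := eval_core a (lact (bvec m'.1.1) _) _.
  rewrite wmul_mid -lact_ract -wmul_ract /Y -eval_core_lact -lactM.
  rewrite eval_core_lact -{2}(bcoordK B (bvec m.2 * bvec m'.1.1)).
  pose G w := ract (wmul X (lact w (eval_core a (a m'.1.2.1) m'.1.2.2)))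
                   (bvec m'.2).
  have Glin : linear G.
    apply: (lin_comp (ract_linl _)); apply: (lin_comp (wmul_linr _)).
    exact: lact_linl.
  rewrite -/(G _) (lin_mlin _ _ Glin); apply: eq_mlin => k.
  rewrite wevalS /= /eval_core foldl_cat /= -!/(eval_core _ _ _) wmul_mid.
  by rewrite eval_core_wmul /G /X !eval_core_lact.
- move=> w; apply: free_ind => [||m].
  + by apply: (lin_comp (weval_lin a)); exact: free_lact_linr.
  + by apply: (lin_comp (lact_linr w)); exact: weval_lin.
  rewrite monE [lact w (sandwich _ _ _)]free_lactS !wevalS lactM.
  by rewrite eval_core_lact lact_ract.
- move=> f w; move: f; apply: free_ind => [||m].
  + by apply: (lin_comp (weval_lin a)); exact: free_ract_linl.
  + by apply: (lin_comp (ract_linl w)); exact: weval_lin.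
  by rewrite monE [ract (sandwich _ _ _) w]free_ractS !wevalS ractM.
Qed.

Lemma weval_uniq a (phi : freeW -> A) :
  walg_morph phi -> (forall j, phi (xvar j) = a j) -> phi =1 weval a.
Proof.
case=> plin pmul pl pr px; apply: free_ind => // [|[[l [j s]] r]].
  exact: weval_lin.
have xE w i w' : sandwich w (i, [::]) w' = ract (lact w (xvar i)) w'.
  by rewrite [lact _ _]free_lactS [ract _ _]free_ractS mulr1 mul1r.
rewrite monE /=; move: (bvec r) => w'; elim/last_ind: s w' => [|s p IH] w'.
  by rewrite wevalS xE pr pl px.
have -> : sandwich (bvec l) (j, rcons s p) w' =
    wmul (sandwich (bvec l) (j, s) (bvec p.1)) (sandwich 1 (p.2, [::]) w').
  rewrite [wmul _ _]free_mulS mulr1 /sandwich2 bcoordU mlinU scale1r.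
  by rewrite /mjoin /= cats1 -surjective_pairing.
have [_ wM _ _] := weval_morph a.
by rewrite pmul IH wM; congr wmul; rewrite wevalS xE pr pl px.
Qed.

End Evaluation.

Record T_ideal (I : freeW -> Prop) : Prop := {
  T_ideal0 : I 0;
  T_idealD : forall f g, I f -> I g -> I (f + g);
  T_idealZ : forall (c : F) f, I f -> I (c *: f);
  T_ideal_mull : forall f g, I g -> I (wmul f g);
  T_ideal_mulr : forall f g, I f -> I (wmul f g);
  T_ideal_lact : forall w f, I f -> I (lact w f);
  T_ideal_ract : forall f w, I f -> I (ract f w);
  T_ideal_endo : forall phi : freeW -> freeW,
    walg_morph phi -> forall f, I f -> I (phi f)
}.

Definition T_generated (S : freeW -> Prop) (f : freeW) : Prop :=
  forall I, T_ideal I -> (forall p, S p -> I p) -> I f.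

Definition Id (A : walgType W) (f : freeW) : Prop :=
  forall a : nat -> A, weval a f = 0.

Definition mon_vars (m : wmonom) : seq nat := m.1.2.1 :: map snd m.1.2.2.

Definition multilinear (n : nat) (f : freeW) : Prop :=
  forall m, m \in msupp f -> perm_eq (mon_vars m) (iota 0 n).

End FreeWAlgebra.

Section QuotientDimension.
Context {F : fieldType} {V : lmodType F} (P Q : V -> Prop).

Definition quotient_basis d (v : 'I_d -> V) : Prop :=
  [/\ forall i, P (v i),
      forall c : 'I_d -> F, Q (\sum_i c i *: v i) -> forall i, c i = 0 &
      forall u, P u -> exists c : 'I_d -> F, Q (u - \sum_i c i *: v i)].

(* The dimension of P / Q for subspaces Q <= P, None meaning +oo.              *)
Definition quotient_dim : option nat :=
  match excluded_middle_informative
    (exists d, exists v : 'I_d -> V, quotient_basis v) with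
  | left fin => Some (proj1_sig (constructive_indefinite_description _ fin))
  | right _ => None
  end.

End QuotientDimension.

Definition codimension (F : fieldType) (W : algType F) (B : basis W)
    (A : walgType W) (n : nat) : option nat :=
  quotient_dim (multilinear (B := B) n) (fun f => multilinear n f /\ Id A f).

Section GrassmannBasis.
Context (F : fieldType).
Local Notation E := (grassmann F).

Definition gbasis : basis E :=
  @Basis F E {fset nat} (fun A => << A >>) id (@mlin_id F _) (@mlin_id F _).

Local Notation x := (xvar gbasis).
Local Notation e := (gen : nat -> E).

Variant E_trivial : freeW gbasis -> Prop :=
| E_trivial_even (s : seq nat) of ~~ odd (size s) :
    E_trivial (rcomm (x 0) (\prod_(i <- s) e i))
| E_trivial_gen (i j : nat) : E_trivial (rcomm (lcomm (e i) (x 0)) (e j)).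

Variant E_generator : freeW gbasis -> Prop :=
| E_generator_xxx : E_generator (wcomm (wcomm (x 0) (x 1)) (x 2))
| E_generator_exx (i : nat) : E_generator (wcomm (lcomm (e i) (x 0)) (x 1)).

End GrassmannBasis.

(* Main.v *)
Require Import Defs.
From mathcomp Require Import all_boot all_order all_algebra.
From mathcomp Require Import finmap.
From mathcomp.multinomials Require Import monalg.
From HB Require Import structures.
From Stdlib Require Import Setoid Morphisms ClassicalEpsilon.
Import GRing.Theory.
Local Open Scope ring_scope.

(** Every value of a listed generator is zero on E because commutators of E are
    central, and the identities of E form a T-ideal; this is the easy
    inclusion.

    For the converse let I be the T-ideal generated by the listed polynomials,
    and adjoin a unit to E<X>: U = E (+) E<X> is a unital associative algebra and
    0 (+) I is a two-sided ideal of it. Modulo this ideal [u, v, w] = 0 for _all_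
    u, v, w in U (unitization_nilpotent): the generators of I and the
    relations of E say so when u, v, w are taken among the e_i and the elements of
    E<X>, and the rest of E follows because an even word in the e_i is central and
    an odd word is z e_i with z central.

    In an algebra satisfying [u, v, w] = 0 commutators are central and
    [a, b] [c, d] = - [a, c] [b, d] (comm_exchange). Fix N bounding the e_i that
    occur in f, and use the e_i with i < N and the x_j as letters. A product of
    halved commutators of letters is then alternating in all its letters, and
    e_i e_k is itself the halved commutator of e_i and e_k. Straightening shows
    that f is congruent to a linear combination of normal forms: a sorted word
    in the x_j times a monomial alternating in an increasing list T of letters,
    namely a product of halved commutators, preceded by a single e_b when T has
    odd length. This is the content of spanned_mull and spanned_uelt.

    The normal forms are independent on E (normal_forms_independent).
    Substitute y_j + e_(N+j) for x_j, with y_j scalars: the alternating monomial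
    becomes the basis element e_T, where x_j contributes e_(N+j), and the sorted
    word becomes the monomial in the y_j plus terms that only lengthen e_T. So
    in a vanishing combination the coefficient of the shortest e_T is a
    polynomial in the y_j that vanishes identically, and the field is infinite.
    An identity f of E thus has only zero coefficients, which places it in I.

    The codimensions are infinite because the multilinear monomials
    e_i x_1 ... x_n, for all i, take the values e_i at x_1 = ... = x_n = 1. *)

Set Implicit Arguments.
Unset Strict Implicit.
Unset Printing Implicit Defensive.

(** * The unitization of a W-algebra *)

Section ActionLinearity.
Context {F : fieldType} {W : algType F} {A : walgType W}.
Implicit Types (a b : A) (w : W).

Lemma wmulDl a b c : wmul (a + b) c = wmul a c + wmul b c.
Proof. exact: linD (wmul_linl c). Qed.
Lemma wmulDr a b c : wmul a (b + c) = wmul a b + wmul a c.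
Proof. exact: linD (wmul_linr a). Qed.
Lemma wmul0l a : wmul 0 a = 0 :> A.
Proof. exact: lin0 (wmul_linl a). Qed.
Lemma wmul0r a : wmul a 0 = 0 :> A.
Proof. exact: lin0 (wmul_linr a). Qed.
Lemma lactDl w w' a : lact (w + w') a = lact w a + lact w' a.
Proof. exact: linD (lact_linl a). Qed.
Lemma lactDr w a b : lact w (a + b) = lact w a + lact w b.
Proof. exact: linD (lact_linr w). Qed.
Lemma lact0l a : lact (0 : W) a = 0.
Proof. exact: lin0 (lact_linl a). Qed.
Lemma lact0r w : lact w 0 = 0 :> A.
Proof. exact: lin0 (lact_linr w). Qed.
Lemma ractDl a b w : ract (a + b) w = ract a w + ract b w.
Proof. exact: linD (ract_linl w). Qed.
Lemma ractDr a w w' : ract a (w + w') = ract a w + ract a w'.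
Proof. exact: linD (ract_linr a). Qed.
Lemma ract0l w : ract 0 w = 0 :> A.
Proof. exact: lin0 (ract_linl w). Qed.
Lemma ract0r a : ract a (0 : W) = 0.
Proof. exact: lin0 (ract_linr a). Qed.

End ActionLinearity.

(** Commutator arguments need products of elements of W and of A side by side, and
    a unit to start words from; an E-algebra such as E<X> has none. *)
Definition unitization (F : fieldType) (W : algType F) (A : walgType W) : Type :=
  (W * A)%type.

Section Unitization.
Context {F : fieldType} {W : algType F} (A : walgType W).
Local Notation U := (unitization A).

HB.instance Definition _ := GRing.Lmodule.copy U (W * A)%type.

Definition umul (u v : U) : U :=
  (u.1 * v.1, lact u.1 v.2 + ract u.2 v.1 + wmul u.2 v.2).

Definition uone : U := (1, 0).

Fact umulA : associative umul.
Proof.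
move=> [w a] [w' b] [w'' c]; congr pair; rewrite /= ?mulrA //.
rewrite !(lactDr, ractDl, wmulDl, wmulDr) -!lactM -!ractM lact_ract.
rewrite -!lact_wmul wmul_ract wmul_mid wmulA -!addrA.
rewrite [X in _ = _ + (_ + (_ + X))]addrCA [X in _ = _ + (_ + X)]addrCA.
by rewrite [X in _ = _ + (_ + (_ + (_ + X)))]addrCA.
Qed.

Fact umul1 : left_id uone umul.
Proof. by case=> w a; rewrite /umul /= mul1r lact1 ract0l wmul0l !addr0. Qed.

Fact umulr1 : right_id uone umul.
Proof. by case=> w a; rewrite /umul /= mulr1 lact0r ract1 wmul0r add0r addr0. Qed.

Fact umulDl : left_distributive umul +%R.
Proof.
move=> [w a] [w' b] [w'' c]; congr pair; rewrite /= ?mulrDl //.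
by rewrite lactDl ractDl wmulDl [X in X + _ = _]addrACA [LHS]addrACA.
Qed.

Fact umulDr : right_distributive umul +%R.
Proof.
move=> [w a] [w' b] [w'' c]; congr pair; rewrite /= ?mulrDr //.
by rewrite lactDr ractDr wmulDr [X in X + _ = _]addrACA [LHS]addrACA.
Qed.

Fact uone_neq0 : uone != 0.
Proof. by apply/eqP => -[/eqP]; rewrite oner_eq0. Qed.

HB.instance Definition _ := GRing.Zmodule_isNzRing.Build U
  umulA umul1 umulr1 umulDl umulDr uone_neq0.

Fact uscaleAl (c : F) (u v : U) : c *: (u * v) = c *: u * v.
Proof.
congr pair; rewrite /= ?scalerAl // !scalerDr.
by rewrite (linZ c _ (lact_linl _)) (linZ c _ (ract_linl _))
  (linZ c _ (wmul_linl _)).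
Qed.

HB.instance Definition _ := GRing.Lmodule_isLalgebra.Build F U uscaleAl.

Fact uscaleAr (c : F) (u v : U) : c *: (u * v) = u * (c *: v).
Proof.
congr pair; rewrite /= ?scalerAr // !scalerDr.
by rewrite (linZ c _ (lact_linr _)) (linZ c _ (ract_linr _))
  (linZ c _ (wmul_linr _)).
Qed.

HB.instance Definition _ := GRing.Lalgebra_isAlgebra.Build F U uscaleAr.

Definition uscal (w : W) : U := (w, 0).
Definition uelt (a : A) : U := (0, a).

Lemma unitizationE (u : U) : u = uscal u.1 + uelt u.2.
Proof. by case: u => w a; congr pair; rewrite ?addr0 ?add0r. Qed.

Lemma uscalM w w' : uscal w * uscal w' = uscal (w * w').
Proof. by congr pair; rewrite /= lact0r ract0l wmul0l !addr0. Qed.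

Lemma ueltM a b : uelt a * uelt b = uelt (wmul a b).
Proof. by congr pair; rewrite /= ?mul0r // lact0l ract0r !add0r. Qed.

Lemma uscal_elt w a : uscal w * uelt a = uelt (lact w a).
Proof. by congr pair; rewrite /= ?mulr0 // ract0r wmul0l !addr0. Qed.

Lemma uelt_scal a w : uelt a * uscal w = uelt (ract a w).
Proof. by congr pair; rewrite /= ?mul0r // lact0l wmul0r addr0 add0r. Qed.

Lemma uscal_lin : linear uscal.
Proof. by move=> c w w'; congr pair; rewrite /= scaler0 addr0. Qed.

Lemma uelt_lin : linear uelt.
Proof. by move=> c a b; congr pair; rewrite /= scaler0 addr0. Qed.

End Unitization.

(** * Commutators and congruences *)

Section AdjacentTranspositions.
Context {T : eqType} (Q : seq T -> Prop).
Hypothesis Qswap : forall s1 a b s2,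
  Q (s1 ++ a :: b :: s2) -> Q (s1 ++ b :: a :: s2).

Lemma adjacent_shift s1 a s s2 : Q (s1 ++ s ++ a :: s2) <-> Q (s1 ++ a :: s ++ s2).
Proof.
elim: s s1 => [|b s IH] s1 //=.
rewrite -cat_rcons IH cat_rcons; split; exact: Qswap.
Qed.

Lemma adjacent_perm s t : perm_eq s t -> Q s -> Q t.
Proof.
have block s1 s2 s3 p : Q (p ++ s1 ++ s2 ++ s3) -> Q (p ++ s2 ++ s1 ++ s3).
  elim: s2 p => [|a s2 IH] p //= /adjacent_shift.
  by rewrite -!cat_rcons => /IH.
move: s t; apply: catCA_perm_ind => s1 s2 s3; exact: (block _ _ _ [::]).
Qed.

End AdjacentTranspositions.

Definition comm {R : nzRingType} (u v : R) : R := u * v - v * u.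

Section Commutators.
Context {R : nzRingType}.
Implicit Types u v w : R.

Lemma commM u v : u * v = v * u + comm u v.
Proof. by rewrite /comm addrC subrK. Qed.

Lemma commN u v : comm v u = - comm u v.
Proof. by rewrite opprB. Qed.

Lemma comm_mulr u v w : comm u (v * w) = comm u v * w + v * comm u w.
Proof. by rewrite /comm mulrBl mulrBr !mulrA addrA subrK. Qed.

Lemma comm_mull u v w : comm (u * v) w = u * comm v w + comm u w * v.
Proof. by rewrite /comm mulrBl mulrBr !mulrA addrA subrK. Qed.

Lemma commDl u v w : comm (u + v) w = comm u w + comm v w.
Proof. by rewrite /comm mulrDl mulrDr opprD addrACA. Qed.

Lemma commDr u v w : comm u (v + w) = comm u v + comm u w.
Proof. by rewrite /comm mulrDl mulrDr opprD addrACA. Qed.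

Lemma commNl u v : comm (- u) v = - comm u v.
Proof. by rewrite /comm mulNr mulrN opprB addrC opprK. Qed.

Lemma comm_nn u : comm u u = 0.
Proof. exact: subrr. Qed.

End Commutators.

Lemma commZl (F : fieldType) (R : algType F) c (u v : R) :
  comm (c *: u) v = c *: comm u v.
Proof. by rewrite /comm -scalerAl -scalerAr scalerBr. Qed.

Lemma commZr (F : fieldType) (R : algType F) c (u v : R) :
  comm u (c *: v) = c *: comm u v.
Proof. by rewrite /comm -scalerAl -scalerAr scalerBr. Qed.

Record two_sided_ideal (F : fieldType) (U : algType F) (P : U -> Prop) : Prop := {
  tsi0 : P 0;
  tsiD : forall u v, P u -> P v -> P (u + v);
  tsiZ : forall c u, P u -> P (c *: u);
  tsiMl : forall u v, P v -> P (u * v);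
  tsiMr : forall u v, P u -> P (u * v)
}.

Existing Class two_sided_ideal.

(** Congruence modulo an ideal is used as a rewriting relation, so that no
    quotient algebra has to be built. *)
Section Congruence.
Context {F : fieldType} {U : algType F} (P : U -> Prop) {idP : two_sided_ideal P}.

Definition congmod (u v : U) : Prop := P (u - v).

#[export] Instance congmod_equiv : Equivalence congmod.
Proof.
split=> [u|u v h|u v w h1 h2]; rewrite /congmod.
- by rewrite subrr; exact: tsi0.
- by rewrite -opprB -scaleN1r; exact: tsiZ.
- by rewrite -[u](subrK v) -addrA; exact: tsiD.
Qed.

#[export] Instance congmodD : Proper (congmod ==> congmod ==> congmod) +%R.
Proof. by move=> u u' h v v' h'; rewrite /congmod opprD addrACA; exact: tsiD. Qed.

#[export] Instance congmodN : Proper (congmod ==> congmod) -%R.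
Proof. by move=> u u' h; rewrite /congmod -opprD -scaleN1r; exact: tsiZ. Qed.

#[export] Instance congmodZ c : Proper (congmod ==> congmod) ( *:%R c).
Proof. by move=> u u' h; rewrite /congmod -scalerBr; exact: tsiZ. Qed.

#[export] Instance congmodM : Proper (congmod ==> congmod ==> congmod) *%R.
Proof.
move=> u u' h v v' h'; rewrite /congmod.
rewrite -[u * v](subrK (u' * v)) -addrA -mulrBl -mulrBr.
by apply: tsiD => //; [exact: tsiMr | exact: tsiMl].
Qed.

#[export] Instance comm_congmod : Proper (congmod ==> congmod ==> congmod) comm.
Proof. by move=> u u' h v v' h'; rewrite /comm h h'; reflexivity. Qed.

End Congruence.

#[local] Hint Extern 0 (congmod _ _ _) => reflexivity : core.

Lemma scale_halfD (F : fieldType) (V : lmodType F) (u : V) :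
  2%:R != 0 :> F -> 2%:R^-1 *: (u + u) = u.
Proof. by move=> h; rewrite -mulr2n -scaler_nat scalerA mulVf // scale1r. Qed.

(** * Normal forms in algebras with central commutators *)

Section NormalForms.
Context {F : fieldType} {R : algType F} (l : nat -> R).

(** The factor 1/2 is what makes hcomm a b equal to l a * l b for anticommuting
    letters. *)
Definition hcomm (a b : nat) : R := 2%:R^-1 *: comm (l a) (l b).

(** The value 0 at odd lengths makes pairing alternating on lists of every length. *)
Fixpoint pairing (T : seq nat) : R :=
  match T with
  | [::] => 1
  | [:: _] => 0
  | a :: b :: T' => hcomm a b * pairing T'
  end.

(** On increasing lists the letters that stand for generators of E come first, so
    the letter left over at odd length is taken from the head. *)
Definition normal_tail (T : seq nat) : R :=
  if odd (size T) then l (head 0%N T) * pairing (behead T) else pairing T.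

Definition letter_word (s : seq nat) : R := \prod_(i <- s) l i.

Definition nform (k : seq nat * seq nat) : R := letter_word k.1 * normal_tail k.2.

Lemma word_cons a s : letter_word (a :: s) = l a * letter_word s.
Proof. exact: big_cons. Qed.

Lemma word_cat s t : letter_word (s ++ t) = letter_word s * letter_word t.
Proof. exact: big_cat. Qed.

Lemma word_rcons s a : letter_word (rcons s a) = letter_word s * l a.
Proof. by rewrite -cats1 word_cat /letter_word big_seq1. Qed.

Lemma hcommN a b : hcomm b a = - hcomm a b.
Proof. by rewrite /hcomm commN scalerN. Qed.

Lemma hcomm_nn a : hcomm a a = 0.
Proof. by rewrite /hcomm comm_nn scaler0. Qed.

End NormalForms.

Section Spanning.
Context {F : fieldType} {U : algType F} (P : U -> Prop).
Context {idP : two_sided_ideal P}.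
Hypothesis two_neq0 : 2%:R != 0 :> F.
Local Notation "u ≡ v" := (congmod P u v) (at level 70).
Hypothesis nilP : forall u v w, comm (comm u v) w ≡ 0.

Lemma comm_central u v w : comm u v * w ≡ w * comm u v.
Proof. by rewrite [X in X ≡ _]commM nilP addr0. Qed.

(** Expanding [a, b c, d] = 0 leaves [a, b] [c, d] + [b, d] [a, c] = 0, commutators
    being central. *)
Lemma comm_exchange a b c d : comm a b * comm c d ≡ - (comm a c * comm b d).
Proof.
have h : comm a b * comm c d + comm a c * comm b d ≡ 0.
  rewrite -[X in _ ≡ X](nilP a (b * c) d) comm_mulr commDl !comm_mull.
  by rewrite !nilP mul0r mulr0 addr0 add0r [X in _ ≡ _ + X]comm_central.
by rewrite -[X in X ≡ _](addrK (comm a c * comm b d)) h sub0r.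
Qed.

(** The letters below N play the generators of E, the other ones the variables. *)
Context (l : nat -> U) (N : nat).
Hypothesis anti : forall a b, (a < N)%N -> (b < N)%N -> l a * l b = - (l b * l a).
Local Notation q := (hcomm l).
Local Notation pairing := (pairing l).
Local Notation word := (letter_word l).
Local Notation tail := (normal_tail l).

Lemma hcomm_half a b : l a * l b = l b * l a + q a b + q a b.
Proof.
rewrite -addrA -[q a b + _]mulr2n -scaler_nat scalerA divff // scale1r.
exact: commM.
Qed.

Lemma hcomm_central a b u : q a b * u ≡ u * q a b.
Proof. by rewrite -scalerAl -scalerAr comm_central. Qed.

Lemma hcomm_exchange a b c d : q a b * q c d ≡ - (q a c * q b d).
Proof.
by rewrite /hcomm -!scalerAl -!scalerAr -!scalerN comm_exchange.
Qed.

Lemma hcomm_odd a b : (a < N)%N -> (b < N)%N -> l a * l b = q a b.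
Proof.
by move=> aN bN; rewrite /hcomm /comm (anti bN aN) opprK scale_halfD.
Qed.

(** Since l a * l b is half a commutator it is central, and [l a * l b, l c] = 0
    expands to the claim. *)
Lemma hcomm_odd_exchange a b c : (a < N)%N -> (b < N)%N ->
  l a * q b c ≡ - (l b * q a c).
Proof.
move=> aN bN; rewrite /hcomm -!scalerAr -!scalerN.
suff h : l a * comm (l b) (l c) + l b * comm (l a) (l c) ≡ 0.
  by rewrite -[X in X ≡ _](addrK (2%:R^-1 *: (l b * comm (l a) (l c))))
    -scalerDr h scaler0 sub0r scalerN.
rewrite -(comm_central (l a)) -comm_mull (hcomm_odd aN bN) /hcomm commZl nilP.
by rewrite scaler0.
Qed.

(** Swapping two letters of the same commutator changes the sign by antisymmetry,
    swapping letters of neighbouring commutators does so by hcomm_exchange. *)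
Lemma pairing_perm s t : perm_eq s t ->
  exists e : bool, pairing s ≡ (-1) ^+ e *: pairing t.
Proof.
move=> st; apply: (adjacent_perm (Q := fun t => exists e : bool,
  pairing s ≡ (-1) ^+ e *: pairing t) _ st) => [s1 a b s2 [e h]|]; last first.
  by exists false; rewrite scale1r.
exists (~~ e); rewrite h signrN scaleNr -scalerN; apply: congmodZ => {h}.
have [n] := ubnP (size s1); elim: n s1 => // n IH [|c [|d s1]] /= sz.
- by rewrite hcommN mulNr.
- case: {IH} s2 => [|d s2] /=; first by rewrite !mulr0 oppr0.
  by rewrite !mulrA hcomm_exchange mulNr.
- by rewrite IH ?mulrN; [by [] | rewrite -ltnS ltnW].
Qed.

Lemma pairing_dup T : ~~ uniq T -> pairing T ≡ 0.
Proof.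
move=> nu; suff [a [T']] : exists a T', perm_eq T (a :: a :: T').
  by move=> /pairing_perm[e ->] /=; rewrite hcomm_nn mul0r scaler0.
elim: T nu => //= b T IH; rewrite negb_and negbK => /orP[bT|/IH[a [T' TT']]].
  by exists b, (rem b T); rewrite perm_cons perm_to_rem.
exists a, (b :: T'); apply: (perm_trans (y := b :: a :: a :: T')).
  by rewrite perm_cons.
exact: (permEl (perm_catCA [:: b] [:: a; a] T')).
Qed.

Definition nf_index (k : seq nat * seq nat) : bool :=
  [&& sorted leq k.1, all (leq N) k.1, sorted ltn k.2 &
      odd (size k.2) ==> (head 0 k.2 < N)%N].

Definition spanned (u : U) : Prop :=
  exists g : {malg F[(seq nat * seq nat)%type]},
    (forall k, k \in msupp g -> nf_index k) /\ u ≡ mlin (nform l) g.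

#[local] Instance spanned_congmod : Proper (congmod P ==> iff) spanned.
Proof.
by move=> u v uv; split=> -[g [gs h]]; exists g; split; rewrite // -h uv.
Qed.

Lemma spanned0 : spanned 0.
Proof.
by exists 0; split=> [k|]; rewrite ?msupp0 // mlin0.
Qed.

Lemma spannedP c u v : spanned u -> spanned v -> spanned (c *: u + v).
Proof.
move=> [g [gs ->]] [h [hs ->]]; exists (c *: g + h); split; last first.
  by rewrite mlinP.
move=> k /(fsubsetP (msuppD_le _ _)); rewrite in_fsetU => /orP[|/hs //].
by move=> /(fsubsetP (msuppZ_le _ _)) /gs.
Qed.

Lemma spannedZ c u : spanned u -> spanned (c *: u).
Proof. by move=> su; rewrite -[_ *: _]addr0; apply: spannedP => //; exact: spanned0. Qed.

Lemma spannedD u v : spanned u -> spanned v -> spanned (u + v).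
Proof. by move=> su; rewrite -[u]scale1r; exact: spannedP. Qed.

Lemma spannedN u : spanned u -> spanned (- u).
Proof. by rewrite -scaleN1r; exact: spannedZ. Qed.

Lemma spanned_nform k : nf_index k -> spanned (nform l k).
Proof.
move=> gk; exists << k >>; split; last by rewrite mlinU scale1r.
by move=> k' /(fsubsetP msuppU_le); rewrite in_fset1 => /eqP->.
Qed.

(** Reduction to increasing lists: a property of congruence classes that holds at 0
    and is stable under change of sign need only be checked on sorted lists
    without repetition. *)
Lemma pairing_sort T (C : U -> Prop) : (forall u v, u ≡ v -> C v -> C u) ->
  C 0 -> (forall u, C u -> C (- u)) ->
  (uniq T -> C (pairing (sort leq T))) -> C (pairing T).
Proof.
move=> Ccong C0 CN Cs; have [uT|/pairing_dup h] := boolP (uniq T); last exact: Ccong h C0.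
have /pairing_perm[e h] : perm_eq T (sort leq T) by rewrite perm_sym perm_sort.
by apply: Ccong h _; case: e; rewrite ?scale1r ?scaleN1r; [apply: CN|]; exact: Cs.
Qed.

Lemma word_tail_spanned s T :
  all (leq N) s -> sorted leq s -> sorted ltn T ->
  (odd (size T) ==> (head 0 T < N)%N) -> spanned (word s * tail T).
Proof.
move=> sN so To oT; apply: (spanned_nform (k := (s, T))).
by rewrite /nf_index /= so sN To.
Qed.

Lemma sort_ltn T : uniq T -> sorted ltn (sort leq T).
Proof.
by move=> uT; rewrite ltn_sorted_uniq_leq sort_uniq uT sort_sorted //; exact: leq_total.
Qed.

Lemma sorted_even_spanned s T : sorted leq s -> all (leq N) s -> ~~ odd (size T) ->
  spanned (word s * pairing T).
Proof.
move=> so sN eT; apply: (pairing_sort (C := fun u => spanned (word s * u))).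
- by move=> u v uv; rewrite uv.
- by rewrite mulr0; exact: spanned0.
- by move=> u; rewrite mulrN; exact: spannedN.
move=> uT; have := @word_tail_spanned s (sort leq T) sN so (sort_ltn uT).
by rewrite /normal_tail size_sort (negbTE eT) /=; apply.
Qed.

(** If the leading letter l b is not the smallest one, hcomm_odd_exchange trades it
    for the head t of the sorted list, which is below b and hence below N; it also
    kills the product when b = t. *)
Lemma sorted_odd_spanned s b T : sorted leq s -> all (leq N) s -> (b < N)%N ->
  ~~ odd (size T) -> spanned (word s * (l b * pairing T)).
Proof.
move=> so sN bN eT.
have Csort b' T' : ~~ odd (size T') -> (b' < N)%N ->
    (uniq T' -> spanned (word s * (l b' * pairing (sort leq T')))) ->
    spanned (word s * (l b' * pairing T')).
  move=> eT' b'N; apply: (pairing_sort (C := fun u => spanned (word s * (l b' * u)))).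
  - by move=> u v uv; rewrite uv.
  - by rewrite !mulr0; exact: spanned0.
  - by move=> u; rewrite !mulrN; exact: spannedN.
have Cnf b' T' : ~~ odd (size T') -> (b' < N)%N -> path ltn b' T' ->
    spanned (word s * (l b' * pairing T')).
  move=> eT' b'N pT'; have := @word_tail_spanned s (b' :: T') sN so pT'.
  by rewrite /normal_tail /= eT' /=; apply.
apply: (Csort b T) => // uT.
have := sort_ltn uT; have : ~~ odd (size (sort leq T)) by rewrite size_sort.
case: (sort leq T) => [|t [|c T']] // ec st; first exact: Cnf.
have [bt|tb|bt] := ltngtP b t; first by apply: Cnf => //=; rewrite bt.
- have tN := ltn_trans tb bN.
  rewrite /= [l b * _]mulrA hcomm_odd_exchange // mulNr mulrN -mulrA; apply: spannedN.
  rewrite -[q b c * _]/(pairing (b :: c :: T')); apply: Csort => // ubc.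
  apply: Cnf => //; first by rewrite size_sort.
  rewrite (path_sortedE ltn_trans) (sort_ltn ubc) andbT.
  by rewrite all_sort /= tb; exact: (order_path_min ltn_trans st).
- have h : l b * pairing (t :: c :: T') ≡ 0.
    have h0 : l b * q b c ≡ 0.
      by rewrite -[X in X ≡ _](scale_halfD _ two_neq0) {1}hcomm_odd_exchange // addNr scaler0.
    by rewrite -bt /= mulrA h0 mul0r.
  by rewrite h mulr0; exact: spanned0.
Qed.

Lemma word_swap s1 a c s2 X :
  word (s1 ++ c :: a :: s2) * X ≡
  word (s1 ++ a :: c :: s2) * X + 2%:R *: (word (s1 ++ s2) * (q c a * X)).
Proof.
have -> : word (s1 ++ s2) * (q c a * X) ≡ word s1 * (q c a * word s2) * X.
  by rewrite word_cat (hcomm_central c a (word s2)) -!mulrA.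
rewrite scaler_nat mulr2n !word_cat !word_cons [l c * _]mulrA hcomm_half.
by rewrite !(mulrDl, mulrDr) -!mulrA -!addrA.
Qed.

(** Transposing two adjacent letters costs a word with two letters fewer, times a
    commutator that joins the pairing; the induction on the length of the word in
    the two lemmas that follow absorbs it. *)
Lemma word_sort s X :
  (forall c a s', (size s' < size s)%N -> all (leq N) s' ->
     spanned (word s' * (q c a * X))) ->
  all (leq N) s -> spanned (word (sort leq s) * X) -> spanned (word s * X).
Proof.
move=> sX sN ss; have ps : perm_eq (sort leq s) s by rewrite perm_sort.
have psym : perm_eq s (sort leq s) by rewrite perm_sym.
apply: (adjacent_perm (Q := fun t => perm_eq s t -> spanned (word t * X)) _ ps) => //.
move=> s1 a c s2 h pt; rewrite word_swap; apply: spannedD.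
  apply: h; apply: (perm_trans pt); rewrite perm_cat2l.
  by apply: (permEl (perm_catCA [:: c] [:: a] s2)).
apply: spannedZ; apply: sX.
  by rewrite (perm_size pt) !size_cat /= !addnS ltnW.
by move: sN; rewrite (perm_all _ pt) !all_cat /= => /and4P[-> _ _ ->].
Qed.

Lemma word_pairing_spanned s T : all (leq N) s -> ~~ odd (size T) ->
  spanned (word s * pairing T).
Proof.
have [n] := ubnP (size s); elim: n s T => // n IH s T sz sN eT.
apply: word_sort => // [c a s' s's s'N|].
  apply: (IH s' (c :: a :: T)) => //=; last by rewrite negbK.
  exact: leq_trans s's sz.
by apply: sorted_even_spanned; rewrite ?sort_sorted ?all_sort //; exact: leq_total.
Qed.

Lemma word_odd_pairing_spanned s b T : all (leq N) s -> (b < N)%N ->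
  ~~ odd (size T) -> spanned (word s * (l b * pairing T)).
Proof.
have [n] := ubnP (size s); elim: n s T => // n IH s T sz sN bN eT.
apply: word_sort => // [c a s' s's s'N|].
  rewrite [q _ _ * _]mulrA (hcomm_central c a (l b)) -mulrA.
  apply: (IH s' (c :: a :: T)) => //=; last by rewrite negbK.
  exact: leq_trans s's sz.
by apply: sorted_odd_spanned; rewrite ?sort_sorted ?all_sort //; exact: leq_total.
Qed.

(** A letter standing for a generator of E is moved to the right through the
    variables s until it meets the alternating part X. *)
Lemma letter_word_spanned a s1 s X : (a < N)%N ->
  all (leq N) s1 -> all (leq N) s ->
  (forall s' c, all (leq N) s' -> spanned (word s' * (q a c * X))) ->
  (forall s', all (leq N) s' -> spanned (word s' * (l a * X))) ->
  spanned (word s1 * (l a * (word s * X))).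
Proof.
move=> aN s1N sN sq sa; elim: s s1 s1N sN => [|c s IH] s1 s1N.
  by rewrite /letter_word big_nil mul1r => _; exact: sa.
move=> /= /andP[cN sN].
have := word_swap s1 c a s X.
rewrite !word_cat !word_cons -!mulrA => ->; apply: spannedD.
  by rewrite mulrA -word_rcons; apply: IH; rewrite // all_rcons cN.
by apply: spannedZ; rewrite mulrA -word_cat; apply: sq; rewrite all_cat s1N.
Qed.

(** Hence the span of the normal forms is a left ideal of the algebra generated by
    the letters; it contains 1, so it contains every word. *)
Lemma spanned_mull a u : spanned u -> spanned (l a * u).
Proof.
move=> [g [gs ->]]; rewrite mlin.unlock mulr_sumr big_seq.
elim/big_rec: _ => [|[s T] v /gs]; first exact: spanned0.
rewrite /nf_index /= => /and4P[so sN To oT] sv; apply: spannedD => // {sv}.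
rewrite -scalerAr; apply: spannedZ; rewrite /nform /=.
have [Na|aN] := leqP N a.
  rewrite mulrA -word_cons; move: oT; rewrite /normal_tail.
  case: ifP => [oT /= hN|/negbT eT _]; last first.
    by apply: word_pairing_spanned; rewrite //= Na.
  apply: word_odd_pairing_spanned; rewrite //= ?Na //.
  by rewrite size_behead; case: (size T) oT.
(* The letter starts to the right of the empty word. *)
rewrite -[_ * _]mul1r -[1](big_nil _ _ _ _ : word [::] = 1).
apply: letter_word_spanned => //.
- move=> s' c s'N; move: oT; rewrite /normal_tail.
  case: ifP => [oT /= hN|/negbT eT _]; last first.
    by apply: (word_pairing_spanned (T := a :: c :: T)) => //=; rewrite negbK.
  rewrite [q _ _ * _]mulrA (hcomm_central a c (l (head 0%N T))) -mulrA.
  apply: (word_odd_pairing_spanned (T := a :: c :: behead T)) => //=.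
  by rewrite size_behead; case: (size T) oT => //= n; rewrite negbK.
- move=> s' s'N; move: oT; rewrite /normal_tail.
  case: ifP => [oT /= hN|/negbT eT _]; last exact: word_odd_pairing_spanned.
  rewrite [l a * _]mulrA hcomm_odd //.
  apply: (word_pairing_spanned (T := a :: head 0%N T :: behead T)) => //=.
  by rewrite size_behead; case: (size T) oT => //= n; rewrite negbK.
Qed.

Lemma spanned1 : spanned 1.
Proof.
have := @spanned_nform ([::], [::]) isT.
by rewrite /nform /letter_word /= /normal_tail /= big_nil mul1r.
Qed.

End Spanning.

(** * Reducing the identity [u, v, w] = 0 to generators *)

Lemma comm_jacobi (R : nzRingType) (u v w : R) :
  comm (comm u v) w = comm (comm u w) v + comm u (comm v w).
Proof.
rewrite {2}/comm commDl commNl !comm_mull opprD [X in X + _ = _]addrC addrACA.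
by rewrite /comm.
Qed.

Section GrassmannGenerators.
Context {F : fieldType}.
Local Notation E := (grassmann F).

Lemma basis_word (A : {fset nat}) : \prod_(i <- sort leq A) gen i = << A >> :> E.
Proof.
rewrite gen_prod; first by congr << _ >>; apply/fsetP=> i; rewrite seq_fsetE mem_sort.
by rewrite ltn_sorted_uniq_leq sort_uniq fset_uniq sort_sorted //; exact: leq_total.
Qed.

Lemma grassmann_ind (Q : E -> Prop) :
  Q 0 -> (forall c u v, Q u -> Q v -> Q (c *: u + v)) ->
  (forall A : {fset nat}, Q (\prod_(i <- sort leq A) gen i)) -> forall u, Q u.
Proof.
move=> Q0 QP Qw u; rewrite -[u]mlin_id mlin.unlock.
elim/big_rec: _ => // A v _ Qv; apply: QP => //.
by rewrite -basis_word; exact: Qw.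
Qed.

End GrassmannGenerators.

(** The algebra U is a sum of an image of E and of a part of G. This is applied with
    U = E and P = 0, and with U the unitization of E<X> and P given by a T-ideal. *)
Section NilpotencyFromGenerators.
Context {F : fieldType} {U : algType F} (P : U -> Prop).
Context {idP : two_sided_ideal P}.
Hypothesis two_neq0 : 2%:R != 0 :> F.
Local Notation "u ≡ v" := (congmod P u v) (at level 70).

Definition central (u : U) : Prop := forall v, comm u v ≡ 0.

Lemma central0 : central 0.
Proof. by move=> v; rewrite /comm mul0r mulr0 subr0. Qed.

Lemma centralP c u v : central u -> central v -> central (c *: u + v).
Proof. by move=> zu zv w; rewrite commDl commZl zu zv scaler0 addr0. Qed.

Lemma centralZ c u : central u -> central (c *: u).
Proof. by move=> zu w; rewrite commZl zu scaler0. Qed.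

Lemma centralM u v : central u -> central v -> central (u * v).
Proof. by move=> zu zv w; rewrite comm_mull zu zv mulr0 mul0r addr0. Qed.

Lemma central_cong u v : u ≡ v -> central v -> central u.
Proof. by move=> h zv w; rewrite h. Qed.

Context (j : grassmann F -> U) (G : U -> Prop).
Hypothesis jlin : linear j.
Hypothesis jM : forall u v, j (u * v) = j u * j v.
Hypothesis j1 : j 1 = 1.
Hypothesis Gj : forall i, G (j (gen i)).
Hypothesis Gspan : forall u, exists w f, u = j w + f /\ G f.
Hypothesis Gnil : forall a b c, G a -> G b -> G c -> comm (comm a b) c ≡ 0.

Lemma central_on_generators u : (forall a, G a -> comm u a ≡ 0) -> central u.
Proof.
move=> h v; have [w [f [-> Gf]]] := Gspan v.
rewrite commDr (h _ Gf) addr0; move: w => {v f Gf}; apply: grassmann_ind => [|c w w'|A].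
- by rewrite (lin0 jlin) /comm mulr0 mul0r subr0.
- by rewrite jlin commDr commZr => -> ->; rewrite scaler0 addr0.
elim: (sort leq A) => [|i s IH].
  by rewrite big_nil j1 /comm mulr1 mul1r subrr.
by rewrite big_cons jM comm_mulr IH (h _ (Gj i)) mul0r mulr0 addr0.
Qed.

Lemma comm_generators_central a b : G a -> G b -> central (comm a b).
Proof. by move=> Ga Gb; apply: central_on_generators => c; exact: Gnil. Qed.

Lemma gen_mul_central i k : central (j (gen i * gen k)).
Proof.
have -> : j (gen i * gen k) = 2%:R^-1 *: comm (j (gen i)) (j (gen k)).
  rewrite /comm -!jM genM -scaleN1r (linZ _ _ jlin) scaleN1r -opprD scalerN.
  by rewrite scale_halfD.
by apply: centralZ; exact: comm_generators_central.
Qed.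

(** The parity of the length of s decides: pairs of generators are central by
    gen_mul_central, and at most one generator is left over. *)
Lemma gen_word_central s : central (j (\prod_(i <- s) gen i)) \/
  exists z i, central z /\ j (\prod_(i <- s) gen i) = z * j (gen i).
Proof.
elim/last_ind: s => [|s k [zs|[z [i [zz e]]]]].
- by left; rewrite big_nil j1 => v; rewrite /comm mulr1 mul1r subrr.
- by right; exists (j (\prod_(i <- s) gen i)), k; rewrite big_rcons /= jM.
by left; rewrite big_rcons /= jM e -mulrA -jM; exact: centralM (gen_mul_central _ _).
Qed.

Lemma gen_even_central s : ~~ odd (size s) -> central (j (\prod_(i <- s) gen i)).
Proof.
have [n] := ubnP (size s); elim: n s => // n IH [|i [|k s]] //= sz.
  by move=> _ v; rewrite big_nil j1 /comm mulr1 mul1r subrr.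
rewrite negbK => es; rewrite !big_cons mulrA jM; apply: centralM.
  exact: gen_mul_central.
by apply: IH; rewrite // -ltnS ltnW.
Qed.

(** By gen_word_central, [e_A, b] is congruent to 0 or to z [e_i, b] with z central. *)
Lemma comm_generator_central u b : (forall a, G a -> central (comm a b)) ->
  central (comm u b).
Proof.
move=> h; have [w [f [-> Gf]]] := Gspan u.
rewrite commDl -[comm (j w) b]scale1r; apply: centralP; last exact: h.
move: w => {u f Gf}; apply: grassmann_ind => [|c w w'|A].
- by rewrite (lin0 jlin) /comm mul0r mulr0 subrr; exact: central0.
- by rewrite jlin commDl commZl; exact: centralP.
case: (gen_word_central (sort leq A)) => [z|[z [i [zz ->]]]].
  by apply: central_cong central0; exact: z.
apply: (@central_cong _ (z * comm (j (gen i)) b)).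
  by rewrite comm_mull zz mul0r addr0.
by apply: centralM => //; exact: h.
Qed.

Lemma nilpotent_of_generators u v w : comm (comm u v) w ≡ 0.
Proof.
suff : central (comm u v) by [].
apply: comm_generator_central => a Ga.
rewrite commN -scaleN1r; apply: centralZ.
by apply: comm_generator_central => b Gb; exact: comm_generators_central.
Qed.

End NilpotencyFromGenerators.

(** * T-ideals and the identities of the Grassmann algebra *)

Lemma linB (F : fieldType) (U V : lmodType F) (f : U -> V) u v :
  linear f -> f (u - v) = f u - f v.
Proof. by move=> lf; rewrite -scaleN1r (linD _ _ lf) (linZ _ _ lf) scaleN1r. Qed.

Section MorphismsAndCommutators.
Context {F : fieldType} {W : algType F} {A A' : walgType W} (phi : A -> A').
Hypothesis mphi : walg_morph phi.

Lemma walg_morph_wcomm a b : phi (wcomm a b) = wcomm (phi a) (phi b).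
Proof. by case: mphi => lin M _ _; rewrite (linB _ _ lin) !M. Qed.

Lemma walg_morph_lcomm w a : phi (lcomm w a) = lcomm w (phi a).
Proof. by case: mphi => lin _ L R; rewrite (linB _ _ lin) L R. Qed.

Lemma walg_morph_rcomm a w : phi (rcomm a w) = rcomm (phi a) w.
Proof. by case: mphi => lin _ L R; rewrite (linB _ _ lin) L R. Qed.

End MorphismsAndCommutators.

Section TIdeals.
Context {F : fieldType} {W : algType F} (B : basis W).

Lemma T_ideal_generated (S : freeW B -> Prop) : T_ideal (T_generated S).
Proof.
split.
- by move=> I TI _; exact: T_ideal0.
- by move=> f g hf hg I TI SI; apply: (T_idealD TI); [exact: hf|exact: hg].
- by move=> c f hf I TI SI; apply: (T_idealZ TI); exact: hf.
- by move=> f g hg I TI SI; apply: (T_ideal_mull TI); exact: hg.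
- by move=> f g hf I TI SI; apply: (T_ideal_mulr TI); exact: hf.
- by move=> w f hf I TI SI; apply: (T_ideal_lact TI); exact: hf.
- by move=> f w hf I TI SI; apply: (T_ideal_ract TI); exact: hf.
- by move=> phi mphi f hf I TI SI; apply: (T_ideal_endo TI) => //; exact: hf.
Qed.

(** Stability under endomorphisms: evaluating phi f at a amounts to evaluating f at
    the values of the phi x_i, by the universal property of W<X>. *)
Lemma T_ideal_Id (A : walgType W) : T_ideal (Id (B := B) A).
Proof.
split.
- by move=> a; exact: lin0 (weval_lin a).
- by move=> f g hf hg a; rewrite (linD _ _ (weval_lin a)) hf hg addr0.
- by move=> c f hf a; rewrite (linZ _ _ (weval_lin a)) hf scaler0.
- move=> f g hg a; have [_ aM _ _] := weval_morph B a.
  by rewrite aM hg wmul0r.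
- move=> f g hf a; have [_ aM _ _] := weval_morph B a.
  by rewrite aM hf wmul0l.
- move=> w f hf a; have [_ _ aL _] := weval_morph B a.
  by rewrite aL hf lact0r.
- move=> f w hf a; have [_ _ _ aR] := weval_morph B a.
  by rewrite aR hf ract0l.
move=> phi [plin pM pL pR] f hf a; have [alin aM aL aR] := weval_morph B a.
rewrite -(hf (fun i => weval a (phi (xvar B i)))).
apply: (weval_uniq (phi := fun g => weval a (phi g))) => //; split.
- exact: lin_comp.
- by move=> g h; rewrite pM aM.
- by move=> w g; rewrite pL aL.
- by move=> g w; rewrite pR aR.
Qed.

Lemma weval_id (f : freeW B) : weval (xvar B) f = f.
Proof.
by apply: esym; apply: (weval_uniq (phi := fun g : freeW B => g)) => //; split=> // c.
Qed.

Lemma substitution (a : nat -> freeW B) : exists phi : freeW B -> freeW B,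
  walg_morph phi /\ forall i, phi (xvar B i) = a i.
Proof. by exists (weval a); split; [exact: weval_morph | exact: weval_xvar]. Qed.

End TIdeals.

Section Soundness.
Context {F : fieldType}.
Hypothesis two_neq0 : 2%:R != 0 :> F.
Local Notation E := (grassmann F).
Local Notation FE := (freeW (gbasis F)).
Let eq0 (u : E) : Prop := u = 0.

Let eq0_ideal : two_sided_ideal eq0.
Proof.
split=> [//|u v -> ->|c u ->|u v ->|u v ->]; rewrite /eq0.
- exact: addr0.
- exact: scaler0.
- exact: mulr0.
- exact: mul0r.
Qed.

Let G (u : E) : Prop := u = 0 \/ exists i, u = gen i.

Let Ggen i : G (gen i). Proof. by right; exists i. Qed.

Let Gspan (u : E) : exists w f, u = w + f /\ G f.
Proof. by exists u, 0; rewrite addr0; split; [|left]. Qed.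

Let Gnil (a b c : E) : G a -> G b -> G c -> congmod eq0 (comm (comm a b) c) 0.
Proof.
rewrite /congmod /eq0 subr0.
have c0l (v : E) : comm 0 v = 0 by rewrite /comm mul0r mulr0 subrr.
have c0r (v : E) : comm v 0 = 0 by rewrite /comm mul0r mulr0 subrr.
case=> [->|[i ->]]; first by rewrite !c0l.
case=> [->|[j ->]]; first by rewrite c0r c0l.
case=> [->|[k ->]]; first by rewrite c0r.
(* Moving e_k past two generators changes the sign twice. *)
have h x y : gen x * gen y * gen k = gen k * (gen x * gen y) :> E.
  by rewrite -mulrA (genM y k) mulrN (mulrA (gen x)) (genM x k) mulNr opprK -mulrA.
by rewrite /comm mulrBl mulrBr (h i j) (h j i) subrr.
Qed.

Lemma grassmann_nilpotent (u v w : E) : comm (comm u v) w = 0.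
Proof.
have := @nilpotent_of_generators F E eq0 eq0_ideal two_neq0 id G (fun _ _ _ => erefl)
  (fun _ _ => erefl) erefl Ggen Gspan Gnil u v w.
by rewrite /congmod /eq0 subr0.
Qed.

Lemma grassmann_even_central s (u : E) : ~~ odd (size s) ->
  comm (\prod_(i <- s) gen i) u = 0.
Proof.
move=> es.
have := @gen_even_central F E eq0 eq0_ideal two_neq0 id G (fun _ _ _ => erefl)
  (fun _ _ => erefl) erefl Ggen Gspan Gnil s es u.
by rewrite /congmod /eq0 subr0.
Qed.

Lemma generators_Id (p : FE) : E_generator p \/ E_trivial p -> Id (regular E) p.
Proof.
move=> h a; have mw := weval_morph (gbasis F) a.
case: h => [[|i]|[s es|i j]].
- rewrite !(walg_morph_wcomm mw).
  exact: (grassmann_nilpotent (weval a _ : E) (weval a _ : E) (weval a _ : E)).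
- rewrite (walg_morph_wcomm mw) (walg_morph_lcomm mw).
  exact: (grassmann_nilpotent (gen i) (weval a _ : E) (weval a _ : E)).
- rewrite (walg_morph_rcomm mw) weval_xvar.
  have : comm (\prod_(i <- s) gen i) (a 0 : E) = 0 by exact: grassmann_even_central.
  by move/(congr1 -%R); rewrite opprB oppr0.
- rewrite (walg_morph_rcomm mw) (walg_morph_lcomm mw).
  exact: (grassmann_nilpotent (gen i) (weval a _ : E) (gen j)).
Qed.

End Soundness.

(** * Normal forms modulo a T-ideal containing the generators *)

Section RelativelyFree.
Context {F : fieldType}.
Hypothesis two_neq0 : 2%:R != 0 :> F.
Local Notation E := (grassmann F).
Local Notation FE := (freeW (gbasis F)).
Local Notation U := (unitization FE).
Context (I : FE -> Prop).
Hypothesis TI : T_ideal I.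
Hypothesis SI : forall p, E_generator p \/ E_trivial p -> I p.

Definition unit_ideal (u : U) : Prop := u.1 = 0 /\ I u.2.
Local Notation "u ≡ v" := (congmod unit_ideal u v) (at level 70).

#[local] Instance unit_ideal_two_sided : two_sided_ideal unit_ideal.
Proof.
split.
- by split=> //; exact: T_ideal0.
- move=> u v [u0 Iu] [v0 Iv]; split; rewrite /= ?u0 ?v0 ?addr0 //.
  exact: (T_idealD TI).
- by move=> c u [u0 Iu]; split; rewrite /= ?u0 ?scaler0 //; exact: (T_idealZ TI).
- move=> u v [v0 Iv]; split; rewrite /= v0 ?mulr0 // ract0r addr0.
  by apply: (T_idealD TI); [exact: (T_ideal_lact TI)|exact: (T_ideal_mull TI)].
- move=> u v [u0 Iu]; split; rewrite /= u0 ?mul0r // lact0l add0r.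
  by apply: (T_idealD TI); [exact: (T_ideal_ract TI)|exact: (T_ideal_mulr TI)].
Qed.

Lemma uelt_ideal (f : FE) : I f -> uelt f ≡ 0.
Proof. by rewrite /congmod subr0. Qed.

Lemma comm_uelt (f g : FE) : comm (uelt f) (uelt g) = uelt (wcomm f g).
Proof. by rewrite /comm !ueltM -(linB _ _ (@uelt_lin _ _ _)). Qed.

Lemma comm_uscal_uelt (w : E) (f : FE) : comm (uscal FE w) (uelt f) = uelt (lcomm w f).
Proof. by rewrite /comm uscal_elt uelt_scal -(linB _ _ (@uelt_lin _ _ _)). Qed.

Lemma comm_uelt_uscal (f : FE) (w : E) : comm (uelt f) (uscal FE w) = uelt (rcomm f w).
Proof. by rewrite /comm uscal_elt uelt_scal -(linB _ _ (@uelt_lin _ _ _)). Qed.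

Lemma comm_uscal (w w' : E) : comm (uscal FE w) (uscal FE w') = uscal FE (comm w w').
Proof. by rewrite /comm !uscalM -(linB _ _ (@uscal_lin _ _ _)). Qed.

Lemma T_xxx f g h : I (wcomm (wcomm f g) h).
Proof.
have [phi [mphi px]] := substitution (nth h [:: f; g]).
have e := eq_trans (walg_morph_wcomm mphi _ _) (f_equal2 wcomm
  (eq_trans (walg_morph_wcomm mphi _ _) (f_equal2 wcomm (px 0%N) (px 1%N))) (px 2%N)).
rewrite -[wcomm _ h]e; apply: (T_ideal_endo TI mphi).
exact: (SI (or_introl (E_generator_xxx F))).
Qed.

Lemma T_exx i g h : I (wcomm (lcomm (gen i) g) h).
Proof.
have [phi [mphi px]] := substitution (nth h [:: g]).
have e := eq_trans (walg_morph_wcomm mphi _ _) (f_equal2 wcomm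
  (eq_trans (walg_morph_lcomm mphi (gen i) _) (f_equal (lcomm (gen i)) (px 0%N))) (px 1%N)).
rewrite -[wcomm _ h]e; apply: (T_ideal_endo TI mphi).
exact: (SI (or_introl (E_generator_exx F i))).
Qed.

Lemma T_exe i g k : I (rcomm (lcomm (gen i) g) (gen k)).
Proof.
have [phi [mphi px]] := substitution (fun=> g).
have e := eq_trans (walg_morph_rcomm mphi _ (gen k)) (f_equal (@rcomm _ _ _ ^~ (gen k))
  (eq_trans (walg_morph_lcomm mphi (gen i) _) (f_equal (lcomm (gen i)) (px 0%N)))).
rewrite -[rcomm _ _]e; apply: (T_ideal_endo TI mphi).
exact: (SI (or_intror (E_trivial_gen F i k))).
Qed.

Lemma T_even i k g : I (rcomm g (gen i * gen k)).
Proof.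
have [phi [mphi px]] := substitution (fun=> g).
have e := eq_trans (walg_morph_rcomm mphi _ (gen i * gen k))
  (f_equal (@rcomm _ _ _ ^~ (gen i * gen k)) (px 0%N)).
rewrite -[rcomm _ _]e; apply: (T_ideal_endo TI mphi).
have := SI (or_intror (@E_trivial_even F [:: i; k] isT)).
by rewrite !big_cons big_nil mulr1.
Qed.

Let G (u : U) : Prop := (exists i, u = uscal FE (gen i)) \/ exists f, u = uelt f.

(** Each triple from G falls under a generator of the T-ideal up to the signs of
    antisymmetry, except [f, g, e_m], which the Jacobi identity reduces to
    [e_m, f, g] and [e_m, g, f]. *)
Lemma unitization_nilpotent (u v w : U) : comm (comm u v) w ≡ 0.
Proof.
apply: (nilpotent_of_generators two_neq0 (j := uscal FE) (G := G)).
- exact: uscal_lin.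
- by move=> x y; rewrite uscalM.
- by [].
- by move=> i; left; exists i.
- by move=> x; exists x.1, (uelt x.2); rewrite -unitizationE; split=> //; right; exists x.2.
have Cexe i f k : comm (comm (uscal FE (gen i)) (uelt f)) (uscal FE (gen k)) ≡ 0.
  by rewrite comm_uscal_uelt comm_uelt_uscal; apply: uelt_ideal; exact: T_exe.
have Cexx i f g : comm (comm (uscal FE (gen i)) (uelt f)) (uelt g) ≡ 0.
  by rewrite comm_uscal_uelt comm_uelt; apply: uelt_ideal; exact: T_exx.
have flip x y z : comm (comm x y) z ≡ 0 -> comm (comm y x) z ≡ 0.
  by move=> h; rewrite (commN x y) commNl h oppr0.
move=> _ _ _ [[i ->]|[f ->]] [[k ->]|[g ->]] [[m ->]|[h ->]].
- by rewrite !comm_uscal grassmann_nilpotent ?(lin0 (@uscal_lin _ _ _)).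
- have e : comm (gen i) (gen k) = 2%:R *: (gen i * gen k) :> E.
    by rewrite /comm (genM k i) opprK scaler_nat mulr2n.
  rewrite comm_uscal e (linZ _ _ (@uscal_lin _ _ _)) commZl commN comm_uelt_uscal.
  by rewrite (uelt_ideal (T_even i k h)) oppr0 scaler0.
- exact: Cexe.
- exact: Cexx.
- exact/flip/Cexe.
- exact/flip/Cexx.
- rewrite (comm_jacobi (uelt f)) (commN (comm (uelt g) (uscal FE (gen m))) (uelt f)).
  by rewrite (flip _ _ _ (Cexx m f g)) (flip _ _ _ (Cexx m g f)) oppr0 addr0.
by rewrite !comm_uelt; apply: uelt_ideal; exact: T_xxx.
Qed.

(** With e_i coded by i < N and x_j by N + j, the letter t is later evaluated at a
    scalar plus e_t for every t. *)
Definition letter (N t : nat) : U :=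
  if (t < N)%N then uscal FE (gen t) else uelt (xvar (gbasis F) (t - N)).

Lemma letter_anti N a b : (a < N)%N -> (b < N)%N ->
  letter N a * letter N b = - (letter N b * letter N a).
Proof.
move=> aN bN; rewrite /letter aN bN !uscalM genM -scaleN1r.
by rewrite (linZ _ _ (@uscal_lin _ _ _)) scaleN1r.
Qed.

Section BoundedGenerators.
Variable N : nat.
Local Notation spanned := (spanned unit_ideal (letter N) N).

(** Multipliers form a subalgebra, so they handle words whose factors are grouped
    from the left, as in eval_core, although spanned_mull multiplies on the
    left. *)
Definition multiplier (u : U) : Prop := forall v, spanned v -> spanned (u * v).

Lemma multiplierM u v : multiplier u -> multiplier v -> multiplier (u * v).
Proof. by move=> mu mv w sw; rewrite -mulrA; apply: mu; exact: mv. Qed.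

Lemma multiplier_letter t : multiplier (letter N t).
Proof.
by apply: spanned_mull => //; [exact: unitization_nilpotent | exact: letter_anti].
Qed.

Lemma multiplier_xvar i : multiplier (uelt (xvar (gbasis F) i)).
Proof.
by have := multiplier_letter (N + i); rewrite /letter ltnNge leq_addr addKn.
Qed.

Definition bounded (A : {fset nat}) : bool := all (fun i => (i < N)%N) A.

Lemma multiplier_bounded A : bounded A -> multiplier (uscal FE << A >>).
Proof.
move=> bA; rewrite -basis_word.
have : all (fun i => (i < N)%N) (sort leq A) by rewrite all_sort.
elim: (sort leq A) => [|i s IH] /= => [_|/andP[iN sN]].
  by rewrite big_nil => v; rewrite mul1r.
rewrite big_cons -uscalM; apply: multiplierM; last exact: IH.
by have := multiplier_letter i; rewrite /letter iN.
Qed.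

Lemma multiplier_core (s : seq (gbasis F * nat)) u : all (bounded \o fst) s -> multiplier (uelt u) ->
  multiplier (uelt (eval_core (xvar (gbasis F)) u s)).
Proof.
elim: s u => //= -[A j] s IH u /= /andP[bA bs] mu; apply: IH => //.
rewrite -ueltM -uelt_scal; apply: multiplierM; last exact: multiplier_xvar.
by apply: multiplierM => //; exact: multiplier_bounded.
Qed.

Lemma spanned_uelt (f : FE) :
  (forall m, m \in msupp f ->
     [&& bounded m.1.1, bounded m.2 & all (bounded \o fst) m.1.2.2]) ->
  spanned (uelt f).
Proof.
move=> bf; rewrite -(weval_id f) /weval mlin.unlock (lin_sum _ _ (@uelt_lin _ _ _)).
rewrite big_seq; elim/big_rec: _ => [|m v /bf]; first exact: spanned0.
case: m => [[l [i s]] r] /= /and3P[bl br bs] sv.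
rewrite (linZ _ _ (@uelt_lin _ _ _)); apply: spannedP => // {sv}.
rewrite /eval_mon /= -uelt_scal -[_ * _]mulr1; apply: multiplierM; last first.
- exact: spanned1.
- exact: multiplier_bounded.
apply: multiplier_core => //; rewrite -uscal_elt; apply: multiplierM.
  exact: multiplier_bounded.
exact: multiplier_xvar.
Qed.

End BoundedGenerators.

End RelativelyFree.

(** * Independence of monomials as functions *)

Section Kronecker.
Local Open Scope nat_scope.

Lemma digits_inj M B (f g : nat -> nat) :
  (forall i, f i < M) -> (forall i, g i < M) ->
  \sum_(i < B) f i * M ^ i = \sum_(i < B) g i * M ^ i ->
  forall i, i < B -> f i = g i.
Proof.
elim: B f g => // B IH f g fM gM.
have split (h : nat -> nat) : \sum_(i < B.+1) h i * M ^ i = (\sum_(i < B) h i.+1 * M ^ i) * M + h 0.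
  rewrite big_ord_recl /= muln1 addnC big_distrl /=; congr (_ + _).
  by apply: eq_bigr => i _; rewrite /bump /= add1n expnSr mulnA.
rewrite !split => e.
have e0 : f 0 = g 0.
  have := congr1 (modn^~ M) e.
  by rewrite !modnMDl !modn_small.
have M0 : 0 < M by apply: leq_ltn_trans (fM 0).
move: e; rewrite e0 => /addIn /eqP; rewrite eqn_pmul2r // => /eqP e [|i] iB //.
exact: (IH (fun i => f i.+1) (fun i => g i.+1)).
Qed.

(** The exponent of X in the monomial indexed by s under the Kronecker substitution
    y_i = X^(M^i): its digits in base M are the multiplicities in s. *)
Definition kronecker M (s : seq nat) : nat := \sum_(i <- s) M ^ i.

Lemma kronecker_count M B s : all (fun i => i < B) s ->
  kronecker M s = \sum_(i < B) count_mem (i : nat) s * M ^ i.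
Proof.
rewrite /kronecker; elim: s => [_|a s IH /= /andP[aB sB]].
  by rewrite big_nil big1.
rewrite big_cons IH // (eq_bigr (fun i : 'I_B =>
  (a == i) * M ^ i + count_mem (i : nat) s * M ^ i)); last by move=> i _; rewrite mulnDl.
rewrite big_split /=; congr (_ + _).
rewrite (bigD1 (Ordinal aB)) //= eqxx mul1n big1 ?addn0 // => i ia.
case: eqP => // e; case/eqP: ia; exact: val_inj.
Qed.

Lemma kronecker_inj M s t : size s < M -> size t < M ->
  kronecker M s = kronecker M t -> perm_eq s t.
Proof.
move=> sM tM; pose B := (\max_(i <- s ++ t) i).+1.
have bound u : {subset u <= s ++ t} -> all (fun i => i < B) u.
  by move=> us; apply/allP => i /us ui; rewrite ltnS (big_rem i ui) leq_maxl.
have sB : all (fun i => i < B) s by apply: bound => i; rewrite mem_cat => ->.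
have tB : all (fun i => i < B) t by apply: bound => i; rewrite mem_cat orbC => ->.
rewrite (kronecker_count M sB) (kronecker_count M tB).
move=> /(@digits_inj M B (fun i => count_mem i s) (fun i => count_mem i t)) h.
apply/allP => i ist; apply/eqP/h.
- by move=> k; apply: leq_ltn_trans (count_size _ _) sM.
- by move=> k; apply: leq_ltn_trans (count_size _ _) tM.
by move/allP: (bound _ (fun _ => id)); exact.
Qed.

End Kronecker.

Section MonomialIndependence.
Context {F : fieldType}.
Hypothesis charF0 : [pchar F] =i pred0.

Lemma natr_inj_char0 (m n : nat) : m%:R = n%:R :> F -> m = n.
Proof.
wlog mn : m n / (m <= n)%N => [hw e|].
  by case/orP: (leq_total m n) => h; [|apply: esym]; apply: hw.
move/eqP; rewrite eq_sym -subr_eq0 -natrB // (iffLR (pcharf0P F) charF0) subn_eq0 => nm.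
by apply/eqP; rewrite eqn_leq mn.
Qed.

Lemma poly_eq0_char0 (p : {poly F}) : (forall t, p.[t] = 0) -> p = 0.
Proof.
move=> h; apply/eqP; apply/negPn/negP => p0.
have := @max_poly_roots _ p [seq i%:R | i <- iota 0 (size p)] p0.
rewrite size_map size_iota ltnn => H; suff : false by []; apply: H.
  by apply/allP => t _; rewrite /root h.
by rewrite map_inj_uniq ?iota_uniq //; exact: natr_inj_char0.
Qed.

(** The Kronecker substitution turns distinct monomials into distinct powers of one
    variable, and a nonzero polynomial in one variable does not vanish on all of an
    infinite field. *)
Lemma monomials_independent (K : eqType) (S : seq K) (m : K -> seq nat) (c : K -> F) :
  uniq S -> {in S &, forall k k', perm_eq (m k) (m k') -> k = k'} ->
  (forall y : nat -> F, \sum_(k <- S) c k * \prod_(i <- m k) y i = 0) ->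
  forall k, k \in S -> c k = 0.
Proof.
move=> uS inj h k0 k0S; pose M := (\max_(k <- S) size (m k)).+1.
have mM k : k \in S -> (size (m k) < M)%N.
  by move=> kS; rewrite ltnS (big_rem k kS) leq_maxl.
pose p : {poly F} := \sum_(k <- S) c k *: 'X^(kronecker M (m k)).
have p0 : p = 0.
  apply: poly_eq0_char0 => t; rewrite -(h (fun i => t ^+ (M ^ i)%N)) horner_sum.
  apply: eq_bigr => k _; rewrite hornerZ hornerXn /kronecker; congr (_ * _).
  by apply: (big_morph (GRing.exp t)) => // a b; rewrite exprD.
have := congr1 (fun p : {poly F} => p`_(kronecker M (m k0))) p0.
rewrite coef0 coef_sum (bigD1_seq k0) //= coefZ coefXn eqxx mulr1 big_seq_cond.
rewrite big1 ?addr0 // => k /andP[kS kk0]; rewrite coefZ coefXn.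
case: eqP => [e|_]; last by rewrite mulr0.
case/eqP: kk0; apply: inj => //; apply: (@kronecker_inj M) => //; exact: mM.
Qed.

End MonomialIndependence.

(** * Independence of the normal forms on the Grassmann algebra *)

Section NormalFormMorphism.
Context {F : fieldType} {R R' : algType F} (phi : R -> R').
Hypothesis phi_lin : linear phi.
Hypothesis phiM : forall u v, phi (u * v) = phi u * phi v.
Hypothesis phi1 : phi 1 = 1.
Context (l : nat -> R) (l' : nat -> R').
Hypothesis phi_l : forall t, phi (l t) = l' t.

Lemma morph_pairing T : phi (pairing l T) = pairing l' T.
Proof.
have [n] := ubnP (size T); elim: n T => // n IH [|a [|b T]] //= sT.
  exact: lin0 phi_lin.
rewrite phiM IH; last by rewrite -ltnS ltnW.
by congr (_ * _); rewrite /hcomm (linZ _ _ phi_lin) /comm (linB _ _ phi_lin) !phiM !phi_l.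
Qed.

Lemma morph_nform k : phi (nform l k) = nform l' k.
Proof.
rewrite /nform phiM; congr (_ * _).
  rewrite /letter_word; elim: k.1 => [|i s IH]; first by rewrite !big_nil.
  by rewrite !big_cons phiM IH phi_l.
by rewrite /normal_tail; case: ifP => _; rewrite ?phiM ?phi_l morph_pairing.
Qed.

End NormalFormMorphism.

Section GrassmannNormalForms.
Context {F : fieldType}.
Hypothesis two_neq0 : 2%:R != 0 :> F.
Local Notation E := (grassmann F).
Variable c : nat -> F.

(** The value given to the letter i: scalars are central, so in commutators it
    counts as the generator alone. *)
Definition shifted (i : nat) : E := c i *: 1 + gen i.

Lemma comm_shifted a b : hcomm shifted a b = gen a * gen b.
Proof.
have z u v : comm (c u *: 1) v = 0 :> E.
  by rewrite commZl /comm mul1r mulr1 subrr scaler0.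
rewrite /hcomm /shifted commDl z add0r commDr commN z oppr0 add0r.
by rewrite /comm (genM b a) opprK scale_halfD.
Qed.

Lemma pairing_shifted T : ~~ odd (size T) ->
  pairing shifted T = \prod_(i <- T) gen i.
Proof.
have [n] := ubnP (size T); elim: n T => // n IH [|a [|b T]] //= sT.
  by rewrite big_nil.
rewrite negbK => eT; rewrite !big_cons mulrA comm_shifted IH //.
by rewrite -ltnS ltnW.
Qed.

Lemma tail_shifted T : sorted ltn T -> (odd (size T) -> c (head 0%N T) = 0) ->
  normal_tail shifted T = << seq_fset tt T >>.
Proof.
move=> sT; rewrite -gen_prod // /normal_tail; case: ifP => [|/negbT eT _].
  case: T {sT} => // a T /= eT /(_ isT) ca.
  by rewrite pairing_shifted // big_cons /shifted ca scale0r add0r.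
exact: pairing_shifted.
Qed.

(** Membership in the span of the basis elements of length greater than n. *)
Definition higher (n : nat) (u : E) : Prop :=
  forall B : {fset nat}, (#|` B| <= n)%N -> u@_B = 0.

Lemma higherP n a u v : higher n u -> higher n v -> higher n (a *: u + v).
Proof.
by move=> hu hv B Bn; rewrite mcoeffD mcoeffZ hu // hv // mulr0 addr0.
Qed.

Lemma gen_mul_basis i (A : {fset nat}) : gen i * << A >> = gbmul [fset i]%fset A :> E.
Proof. exact: gmulUU. Qed.

Lemma higher_gen_basis i (A : {fset nat}) : higher #|` A| (gen i * << A >> : E).
Proof.
move=> B BA; rewrite gen_mul_basis /gbmul; case: ifP => [dA|_]; last exact: mcoeff0.
rewrite mcoeffZ mcoeffU; case: eqP => [e|_]; last by rewrite mulr0n mulr0.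
have : #|` B| = #|` A|.+1.
  rewrite -e cardfsU; move: dA; rewrite -fsetI_eq0 => /eqP ->.
  by rewrite cardfs0 cardfs1 subn0.
by move=> e'; rewrite e' ltnn in BA.
Qed.

Lemma higher_gen n i u : higher n u -> higher n (gen i * u).
Proof.
move=> hu B Bn; rewrite -[u]mlin_id mlin.unlock mulr_sumr.
rewrite (big_morph _ (mcoeffD B) (mcoeff0 B)) big1 // => A _.
rewrite -scalerAr mcoeffZ; have [AB|BA] := leqP #|` A| n.
  by rewrite hu // mul0r.
by rewrite higher_gen_basis ?mulr0 // (leq_trans Bn) // ltnW.
Qed.

(** Each factor c i + e_i either contributes its scalar or lengthens the basis
    element. *)
Lemma word_shifted s (A : {fset nat}) : exists2 r, higher #|` A| r &
  letter_word shifted s * << A >> = (\prod_(i <- s) c i) *: << A >> + r.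
Proof.
elim: s => [|i s [r hr e]].
  exists 0 => [B _|]; first exact: mcoeff0.
  by rewrite /letter_word !big_nil mul1r scale1r addr0.
exists (c i *: r + gen i * ((\prod_(j <- s) c j) *: << A >> + r)).
  apply: higherP => //; rewrite mulrDr -scalerAr; apply: higherP.
    exact: higher_gen_basis.
  exact: higher_gen.
rewrite word_cons -mulrA e /shifted mulrDl -scalerAl mul1r scalerDr scalerA.
by rewrite big_cons addrA.
Qed.

Lemma mcoeff_word_shifted s (A B : {fset nat}) : (#|` B| <= #|` A|)%N ->
  (letter_word shifted s * << A >> : E)@_B = (\prod_(i <- s) c i) * (A == B)%:R.
Proof.
move=> BA; have [r hr ->] := word_shifted s A.
by rewrite mcoeffD mcoeffZ mcoeffU hr // addr0.
Qed.

End GrassmannNormalForms.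

Section Independence.
Context {F : fieldType}.
Hypothesis charF0 : [pchar F] =i pred0.
Variable N : nat.

(** The letters below N are the generators of E themselves, so they get no scalar
    part. *)
Definition above (y : nat -> F) (i : nat) : F := if (i < N)%N then 0 else y i.

(** Take k0 in the support of g with the list k0.2 as short as possible. At the basis
    element e_(k0.2) only the normal forms with the same alternating part
    contribute, each by its monomial in y, and monomials_independent
    applies. *)
Lemma normal_forms_independent (g : {malg F[(seq nat * seq nat)%type]}) :
  (forall k, k \in msupp g -> nf_index N k) ->
  (forall y : nat -> F, mlin (nform (shifted (above y))) g = 0) -> g = 0.
Proof.
move=> gs g0; have two_neq0 : 2%:R != 0 :> F by rewrite (iffLR (pcharf0P F) charF0).
apply/malgP => k0; rewrite mcoeff0; apply/eqP; rewrite mcoeff_eq0.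
apply/negP; have [n] := ubnP (size k0.2); elim: n k0 => // n IH k0 k0n k0g.
(* The induction hypothesis leaves no index with a shorter list. *)
have min k : k \in msupp g -> (size k0.2 <= size k.2)%N.
  move=> kg; rewrite leqNgt; apply/negP => kk0; apply: (IH k) => //.
  exact: leq_trans kk0 k0n.
have card k : k \in msupp g -> #|` seq_fset tt k.2| = size k.2.
  move=> /gs /and4P[_ _ sk _]; rewrite size_seq_fset undup_id //.
  by move: sk; rewrite ltn_sorted_uniq_leq => /andP[].
pose S := [seq k <- msupp g | k.2 == k0.2].
have k0S : k0 \in S by rewrite mem_filter eqxx.
have := @monomials_independent F charF0 _ S fst (fun k => g@_k).
move/(_ (filter_uniq _ (fset_uniq _)))=> h.
suff : g@_k0 = 0 by move/eqP; rewrite mcoeff_eq0 k0g.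
apply: h => // [k k'|y].
  rewrite !mem_filter => /andP[/eqP k2 kg] /andP[/eqP k'2 k'g].
  have /and4P[so _ _ _] := gs _ kg; have /and4P[so' _ _ _] := gs _ k'g.
  move=> /(sorted_eq leq_trans anti_leq so so') e.
  by rewrite [k]surjective_pairing [k']surjective_pairing e k2 k'2.
have := congr1 (mcoeff (seq_fset tt k0.2)) (g0 y).
rewrite mcoeff0 mlin.unlock (big_morph _ (mcoeffD _) (mcoeff0 (_ : {fset nat}))) => e.
apply: (eq_trans _ e); rewrite {e} big_filter [LHS]big_mkcond [LHS]big_seq [RHS]big_seq /=.
apply: eq_bigr => k kg.
have /and4P[_ kN sk ok] := gs _ kg.
rewrite mcoeffZ /nform tail_shifted //; last first.
  by move=> o; move: ok; rewrite o /above => /= ->.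
rewrite mcoeff_word_shifted ?card //; last exact: min.
have -> : (seq_fset tt k.2 == seq_fset tt k0.2) = (k.2 == k0.2).
  apply/eqP/eqP => [e|-> //]; have /and4P[_ _ sk0 _] := gs _ k0g.
  apply: (irr_sorted_eq ltn_trans ltnn sk sk0) => i.
  by have := congr1 (fun A : {fset nat} => i \in A) e; rewrite !seq_fsetE.
case: eqP => _; last by rewrite !mulr0.
rewrite mulr1; congr (_ * _); rewrite !big_seq; apply: eq_bigr => i ik.
by rewrite /above ltnNge; move/allP: kN => /(_ i ik) ->.
Qed.

End Independence.

(** * The identities and the codimensions *)

Section UnitizationEvaluation.
Context {F : fieldType}.
Local Notation E := (grassmann F).
Local Notation FE := (freeW (gbasis F)).
Variable a : nat -> regular E.

Definition ueval (u : unitization FE) : E := u.1 + (weval a u.2 : E).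

Lemma ueval_lin : linear ueval.
Proof.
move=> c u v; rewrite /ueval /= (weval_lin a c u.2 v.2).
by rewrite scalerDr addrACA.
Qed.

Lemma uevalM u v : ueval (u * v) = ueval u * ueval v.
Proof.
have [_ M L R] := weval_morph (gbasis F) a.
rewrite /ueval /= !(linD _ _ (weval_lin a)) M L R mulrDl !mulrDr.
by rewrite -!addrA.
Qed.

Lemma ueval1 : ueval 1 = 1.
Proof. by rewrite /ueval /= (lin0 (weval_lin a)) addr0. Qed.

End UnitizationEvaluation.

Section Main.
Context {F : fieldType}.
Hypothesis charF0 : [pchar F] =i pred0.
Local Notation E := (grassmann F).
Local Notation FE := (freeW (gbasis F)).
Local Notation generated := (T_generated (fun p : FE => E_generator p \/ E_trivial p)).

Let two_neq0 : 2%:R != 0 :> F.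
Proof. by rewrite (iffLR (pcharf0P F) charF0). Qed.

Lemma generated_Id (f : FE) : generated f -> Id (regular E) f.
Proof.
by move=> h; apply: h; [exact: T_ideal_Id | move=> p; exact: generators_Id].
Qed.

Lemma generators_bounded (f : FE) : exists N, forall m, m \in msupp f ->
  [&& bounded N m.1.1, bounded N m.2 & all (bounded N \o fst) m.1.2.2].
Proof.
have lemax (T : eqType) (h : T -> nat) x s : x \in s -> (h x <= \max_(y <- s) h y)%N.
  by move=> xs; rewrite (big_rem x xs) leq_maxl.
pose idx (m : wmonom (gbasis F)) : seq {fset nat} := m.1.1 :: m.2 :: map fst m.1.2.2.
pose maxm m := \max_(A <- idx m) \max_(i <- (A : {fset nat})) i.
exists (\max_(m <- msupp f) maxm m).+1 => m mf.
have b (A : {fset nat}) : A \in idx m -> bounded (\max_(m <- msupp f) maxm m).+1 A.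
  move=> Am; apply/allP => i iA; rewrite ltnS.
  apply: leq_trans (lemax _ id i _ iA) _; apply: leq_trans (lemax _ maxm m _ mf).
  exact: (lemax _ (fun A : {fset nat} => \max_(i <- A) i)%N).
rewrite !b ?inE ?eqxx ?orbT //=; apply/allP => p ps /=; apply: b.
by rewrite !inE map_f ?orbT.
Qed.

(** The generated T-ideal is contained in the identities of E, so the combination g
    of normal forms congruent to f vanishes under the same evaluations as f. *)
Lemma Id_generated (f : FE) : Id (regular E) f -> generated f.
Proof.
move=> idf; have [N bN] := generators_bounded f.
have TI := T_ideal_generated (fun p : FE => E_generator p \/ E_trivial p).
have SI p : E_generator p \/ E_trivial p -> generated p by move=> Sp I _; apply.
have [g [gs fg]] := spanned_uelt two_neq0 TI SI bN.
suff g0 : g = 0 by case: fg => _; rewrite g0 mlin0 subr0.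
apply: (normal_forms_independent charF0 gs) => y.
pose a i : regular E := shifted (above N y) (N + i).
have al := ueval_lin a.
have letterE t : ueval a (letter N t) = shifted (above N y) t.
  rewrite /letter /ueval; case: ltnP => [tN|Nt] /=.
    by rewrite (lin0 (weval_lin a)) addr0 /shifted /above tN scale0r add0r.
  by rewrite add0r weval_xvar /a subnKC.
transitivity (ueval a (mlin (nform (letter N)) g)).
  rewrite (lin_mlin _ _ al); apply: eq_mlin => k; apply: esym.
  by apply: (morph_nform al _ _ letterE); [exact: uevalM | exact: ueval1].
case: fg => fg1 /generated_Id /(_ a) fg2.
have : ueval a (uelt f - mlin (nform (letter N)) g) = 0.
  by rewrite /ueval fg1 add0r; exact: fg2.
rewrite (linB _ _ al) {1}/ueval /= idf addr0 sub0r => /eqP.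
by rewrite oppr_eq0 => /eqP.
Qed.

(** If d vectors spanned the quotient, d + 1 of the elements e_i x_1 ... x_n would be
    dependent modulo the identities, and evaluation at 1 would make e_0, ..., e_d
    dependent in E. *)
Lemma infinite_codimension n : (0 < n)%N ->
  codimension (gbasis F) (regular E) n = None.
Proof.
case: n => // n _; rewrite /codimension /quotient_dim.
case: excluded_middle_informative => // fin; exfalso.
case: fin => d [v [_ _ span]].
(* The empty set indexes the unit of E. *)
pose u (i : nat) : FE := mon (([fset i]%fset : gbasis F),
  (0%N, [seq (fset0 : gbasis F, j) | j <- iota 1 n]), (fset0 : gbasis F)).
have uml i : multilinear n.+1 (u i).
  move=> m /(fsubsetP msuppU_le); rewrite in_fset1 => /eqP->.
  by rewrite /mon_vars /= -map_comp map_id.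
pose a (i : nat) : regular E := (1 : E).
have ua i : weval a (u i) = gen i.
  rewrite /weval mlinU scale1r /eval_mon /=.
  have core s (w : regular E) :
      eval_core (B := gbasis F) a w [seq (fset0 : gbasis F, j) | j <- s] = w.
    elim: s w => //= j s IH w; rewrite IH.
    exact: (etrans (mulr1 (_ : E)) (mulr1 (w : E))).
  by rewrite core; exact: (etrans (mulr1 (_ : E)) (mulr1 (_ : E))).
have [c cP] : exists c : 'I_d.+1 -> 'I_d -> F, forall i : 'I_d.+1,
    gen i = \sum_j c i j *: (weval a (v j) : E).
  apply: (fin_all_exists (P := fun (i : 'I_d.+1) (c : 'I_d -> F) =>
    gen i = \sum_j c j *: (weval a (v j) : E))) => i; have [c [_ /(_ a)]] := span _ (uml i).
  rewrite (linB _ _ (weval_lin a)) ua => /subr0_eq e; exists c; rewrite e.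
  rewrite (lin_sum _ _ (weval_lin a)); apply: eq_bigr => j _.
  exact: (linZ _ _ (weval_lin a)).
pose C : 'M[F]_(d.+1, d) := \matrix_(i, j) c i j.
have /rowV0Pn[b /sub_kermxP bC b0] : kermx C != 0.
  by rewrite kermx_eq0 /row_free neq_ltn ltnS rank_leq_col.
have : \sum_(i < d.+1) b 0 i *: gen i = 0 :> E.
  under eq_bigr => i _ do rewrite cP scaler_sumr.
  rewrite exchange_big big1 //= => j _; under eq_bigr => i _ do rewrite scalerA.
  rewrite -scaler_suml; have /rowP/(_ j) := bC; rewrite !mxE => bCj.
  rewrite (eq_bigr (fun i => b 0 i * C i j)) ?bCj ?scale0r // => i _.
  by rewrite mxE.
move=> e; case/eqP: b0; apply/rowP => i; rewrite mxE.
have coef (k : 'I_d.+1) : (b 0 k *: (gen k : E))@_[fset (i : nat)]%fset =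
    if k == i then b 0 i else 0.
  rewrite mcoeffZ mcoeffU; case: (eqVneq k i) => [->|ki]; first by rewrite eqxx mulr1.
  case: eqP => [/fset1_inj ki'|_]; last by rewrite mulr0.
  by case/eqP: ki; apply: val_inj.
have := congr1 (mcoeff [fset (i : nat)]%fset) e.
rewrite mcoeff0 (big_morph _ (mcoeffD _) (mcoeff0 (_ : {fset nat}))).
by rewrite (eq_bigr _ (fun k _ => coef k)) -big_mkcond big_pred1_eq.
Qed.

End Main.

Theorem theorem8p5 (F : fieldType) (charF0 : [pchar F] =i pred0) :
  (forall f : freeW (gbasis F),
     Id (regular (grassmann F)) f
     <-> T_generated (fun p => E_generator p \/ E_trivial p) f)
  /\ (forall n : nat, (0 < n)%N ->
        codimension (gbasis F) (regular (grassmann F)) n = None).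
Proof.
split=> [f|n]; last exact: infinite_codimension.
by split; [exact: Id_generated | exact: generated_Id].
Qed.
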